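(* Let $(S,\mathfrak n)$ be a commutative noetherian local ring and let $\omega\in\mathfrak n$ be a non-zerodivisor. Let $\xi$ be the class of all short exact sequences in $\mathsf{MF}(\omega,\mathcal G)$. Then $(\mathsf{MF}(\omega,\mathcal G),\xi)$ is an exact category. Moreover, $\mathsf{MF}(\omega,\mathcal G)$ is a Frobenius category, and its projective-injective objects are exactly the direct summands of finite direct sums of objects of the form $$(P\xrightarrow{\omega}P,\ P\xrightarrow{\mathrm{id}}P)\ \oplus\ (Q\xrightarrow{\mathrm{id}}Q,\ Q\xrightarrow{\omega}Q)$$ for some finitely generated projective $S$-modules $P,Q$.
   Context: All modules are finitely generated. A finitely generated $S$-module $M$ is Gorenstein projective if $\mathrm{Ext}^i_S(M,S)=0=\mathrm{Ext}^i_S(\mathrm{Hom}_S(M,S),S)$ for all $i\ge 1$ and the biduality map $M\to \mathrm{Hom}_S(\mathrm{Hom}_S(M,S),S)$ is an isomorphism; $\mathcal G(S)$ is the category of finitely generated Gorenstein projective $S$-modules. $\mathsf{MF}(\omega,\mathcal G)$ is the category whose objects are ordered pairs of $S$-homomorphisms $(G_1\xrightarrow{g_1}G_0,\ G_0\xrightarrow{g_0}G_1)$ with $G_1,G_0\in\mathcal G(S)$, $g_1g_0=\omega\cdot\mathrm{id}_{G_0}$ and $g_0g_1=\omega\cdot\mathrm{id}_{G_1}$; a morphism $(g_1,g_0)\to(g_1',g_0')$ is a pair of $S$-homomorphisms $\phi_1:G_1\to G_1'$, $\phi_0:G_0\to G_0'$ with $g_1'\phi_1=\phi_0g_1$ and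 $g_0'\phi_0=\phi_1g_0$. Short exact sequences in $\mathsf{MF}(\omega,\mathcal G)$ are the sequences that are short exact in each of the two components (as $S$-modules). A map labelled $\omega$ is multiplication by $\omega$. ''Exact category'' is in the sense of Quillen, with $\xi$ as class of conflations. A Frobenius category is an exact category with enough projective objects and enough injective objects (relative to the conflations) in which the projective objects coincide with the injective objects. *)

(* Defs.v *)
From HB Require Import structures.
From mathcomp Require Import all_boot all_algebra.
From mathcomp Require Import boolp.

Set Implicit Arguments.
Unset Strict Implicit.
Unset Printing Implicit Defensive.

Import GRing.Theory.
Local Open Scope ring_scope.

(* [idealr_closed I] says that I is a proper ideal. *)

Definition maximal_ideal (S : comNzRingType) (n : {pred S}) : Prop :=
  idealr_closed n /\
  forall I : {pred S}, idealr_closed I -> {subset n <= I} -> I =i n.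

Definition local_ring (S : comNzRingType) (n : {pred S}) : Prop :=
  maximal_ideal n /\ forall I : {pred S}, maximal_ideal I -> I =i n.

(* Only proper ideals need to be tested: the unit ideal is generated by 1. *)
Definition noetherian (S : comNzRingType) : Prop :=
  forall I : {pred S}, idealr_closed I ->
  exists (k : nat) (a : 'I_k -> S),
    forall x, x \in I <-> exists c : 'I_k -> S, x = \sum_i c i * a i.

Lemma linear_ext (S : pzRingType) (U V : lmodType S) (f g : {linear U -> V}) :
  (forall x, f x = g x) -> f = g.
Proof.
case: f g => [f [[f1] [f2]]] [g [[g1] [g2]]] /= /funext fg.
rewrite fg in f1 f2 *.
by rewrite (Prop_irrelevance f1 g1) (Prop_irrelevance f2 g2).
Qed.

Section LinearZmodule.
Context (S : pzRingType) (U V : lmodType S).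
Implicit Types f g h : {linear U -> V}.

HB.instance Definition _ := gen_eqMixin {linear U -> V}.
HB.instance Definition _ := gen_choiceMixin {linear U -> V}.

Definition lin0 : {linear U -> V} := \0.
Definition linD f g : {linear U -> V} := f \+ g.
Definition linN f : {linear U -> V} := \- f.

Lemma linDA : associative linD.
Proof. by move=> f g h; apply: linear_ext => x /=; rewrite addrA. Qed.
Lemma linDC : commutative linD.
Proof. by move=> f g; apply: linear_ext => x /=; rewrite addrC. Qed.
Lemma lin0D : left_id lin0 linD.
Proof. by move=> f; apply: linear_ext => x /=; rewrite add0r. Qed.
Lemma linND : left_inverse lin0 linN linD.
Proof. by move=> f; apply: linear_ext => x /=; rewrite addNr. Qed.

HB.instance Definition _ :=
  GRing.isZmodule.Build {linear U -> V} linDA linDC lin0D linND.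

Lemma lin_addE f g x : (f + g) x = f x + g x. Proof. by []. Qed.
Lemma lin_oppE f x : (- f) x = - f x. Proof. by []. Qed.
Lemma lin_zeroE x : (0 : {linear U -> V}) x = 0. Proof. by []. Qed.

End LinearZmodule.

Section LinearLmodule.
Context (S : comNzRingType) (U V : lmodType S).
Implicit Types f g : {linear U -> V}.

Definition linZ (a : S) f : {linear U -> V} := a \*: f.

Lemma linZA a b f : linZ a (linZ b f) = linZ (a * b) f.
Proof. by apply: linear_ext => x /=; rewrite scalerA. Qed.
Lemma lin1Z : left_id 1 linZ.
Proof. by move=> f; apply: linear_ext => x /=; rewrite scale1r. Qed.
Lemma linZDr : right_distributive linZ +%R.
Proof. by move=> a f g; apply: linear_ext => x /=; rewrite scalerDr. Qed.
Lemma linZDl f : {morph linZ^~ f : a b / a + b}.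
Proof. by move=> a b; apply: linear_ext => x /=; rewrite scalerDl. Qed.

HB.instance Definition _ :=
  GRing.Zmodule_isLmodule.Build S {linear U -> V} linZA lin1Z linZDr linZDl.

Lemma lin_scaleE a f x : (a *: f) x = a *: f x. Proof. by []. Qed.

End LinearLmodule.

Lemma lin_sumE (S : pzRingType) (U V : lmodType S) (I : finType)
    (F : I -> {linear U -> V}) x : (\sum_i F i) x = \sum_i F i x.
Proof. by elim/big_ind2: _ => // f a g b <- <-. Qed.

Section Modules.
Variable S : comNzRingType.
Implicit Types M N P : lmodType S.

Definition surjective (A B : Type) (f : A -> B) : Prop :=
  forall y, exists x, f x = y.

Definition exact_at (A : Type) (B C : zmodType) (f : A -> B) (g : B -> C) :=
  forall y, g y = 0 <-> exists x, f x = y.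

Definition fin_gen M : Prop :=
  exists (k : nat) (e : 'I_k -> M),
    forall x, exists c : 'I_k -> S, x = \sum_i c i *: e i.

Definition projective P : Prop :=
  forall (A B : lmodType S) (p : {linear A -> B}) (f : {linear P -> B}),
    surjective p -> exists g : {linear P -> A}, forall x, p (g x) = f x.

Definition fg_projective P : Prop := fin_gen P /\ projective P.

Record proj_resolution M := ProjResolution {
  res_mod : nat -> lmodType S;
  res_diff : forall k, {linear res_mod k.+1 -> res_mod k};
  res_aug : {linear res_mod 0 -> M};
  res_projective : forall k, projective (res_mod k);
  res_aug_surj : surjective res_aug;
  res_exact0 : exact_at (res_diff 0) res_aug;
  res_exactS : forall k, exact_at (res_diff k.+1) (res_diff k)
}.

Definition precomp N (A B : lmodType S) (d : {linear A -> B})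
  (f : {linear B -> N}) : {linear A -> N} := f \o d.

Definition res_cohomology_vanishes N M (P : proj_resolution M) (i : nat) :=
  match i with
  | 0 => injective (precomp (N := N) (res_diff P 0))
  | j.+1 => exact_at (precomp (N := N) (res_diff P j))
                     (precomp (N := N) (res_diff P j.+1))
  end.

(* Ext^i(M, N) = 0.  The cohomology of Hom(P, N) does not depend on the
   projective resolution P of M, so it may be computed with any one of them. *)
Definition Ext_vanishes (i : nat) M N : Prop :=
  exists P : proj_resolution M, res_cohomology_vanishes N P i.

Local Notation dual M := {linear M -> S^o}.

Section Biduality.
Variable M : lmodType S.

Definition eval_at (x : M) (f : dual M) : S^o := f x.

Lemma eval_at_linear x : linear (eval_at x).
Proof. by []. Qed.
HB.instance Definition _ x :=
  GRing.isLinear.Build S (dual M) S^o *:%R (eval_at x) (eval_at_linear x).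

Definition biduality (x : M) : dual (dual M) := eval_at x.

Lemma biduality_linear : linear biduality.
Proof. by move=> a x y; apply: linear_ext => f; exact: linearP. Qed.
HB.instance Definition _ :=
  GRing.isLinear.Build S M (dual (dual M)) *:%R biduality biduality_linear.

End Biduality.

Definition gorenstein_projective M : Prop :=
  [/\ fin_gen M,
      forall i, (0 < i)%N -> Ext_vanishes i M S^o,
      forall i, (0 < i)%N -> Ext_vanishes i (dual M) S^o
    & bijective (biduality (M := M))].

Lemma projective_Ext P N i : projective P -> (0 < i)%N -> Ext_vanishes i P N.
Proof.
case: i => // i projP _.
pose Z : lmodType S := 'rV[S]_0.
have Z0 (x : Z) : x = 0 by apply/rowP; case.
pose m k : lmodType S := if k is 0 then P else Z.
have projm k : projective (m k).
  case: k => [|k] //= A B p f _; exists (0 : {linear Z -> A}) => x.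
  by rewrite (Z0 x) !linear0.
have s1 : surjective (idfun : {linear m 0%N -> P}) by move=> y; exists y.
have e0 : exact_at (0 : {linear m 1%N -> m 0%N}) (idfun : {linear m 0%N -> P}).
  by move=> y; split=> [/= ->|[x <-] //]; exists 0.
have eS k : exact_at (0 : {linear m k.+2 -> m k.+1})
                     (0 : {linear m k.+1 -> m k}).
  by move=> y; split=> // _; exists 0; rewrite (Z0 y).
exists (@ProjResolution P m (fun k => 0) idfun projm s1 e0 eS) => f /=.
split=> [_|_].
  by exists 0; apply: linear_ext => x; rewrite (Z0 x) !linear0.
by apply: linear_ext => x; rewrite (Z0 x) !linear0.
Qed.

Lemma dual_basis P : fg_projective P ->
  exists (k : nat) (e : 'I_k -> P) (f : 'I_k -> {linear P -> S^o}),
    forall x, x = \sum_i (f i x : S) *: e i.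
Proof.
case=> -[k [e gen_e]] projP.
pose p (v : 'rV[S]_k) := \sum_i v 0 i *: e i.
have p_lin : linear p.
  move=> a u v; rewrite /p scaler_sumr -big_split; apply: eq_bigr => i _ /=.
  by rewrite !mxE scalerDl scalerA.
pose pL := GRing.isLinear.Build S _ _ *:%R p p_lin.
pose pl : {linear 'rV[S]_k -> P} := HB.pack p pL.
have surj_p : surjective pl.
  move=> y; have [c ->] := gen_e y; exists (\row_i c i).
  by apply: eq_bigr => i _; rewrite mxE.
have [s sE] := projP _ _ pl idfun surj_p.
have f_lin i : linear (fun x => s x 0 i : S^o).
  by move=> a x y; rewrite linearP !mxE.
pose fL i := GRing.isLinear.Build S P S^o *:%R _ (f_lin i).
pose f i : {linear P -> S^o} := HB.pack (fun x => s x 0 i : S^o) (fL i).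
by exists k, e, f => x; rewrite -[LHS]sE.
Qed.

Lemma fg_projective_gorenstein P : fg_projective P -> gorenstein_projective P.
Proof.
move=> fgP; have [k [e [f fE]]] := dual_basis fgP.
have dualE (g : {linear P -> S^o}) : g = \sum_i (g (e i) : S) *: f i.
  apply: linear_ext => x; rewrite lin_sumE {1}(fE x) linear_sum.
  by apply: eq_bigr => i _; rewrite linearZ lin_scaleE /=; exact: mulrC.
case: (fgP) => fgenP projP; split=> //.
- by move=> i; exact: projective_Ext.
- move=> i; apply: projective_Ext => A B p g surj_p.
  have [a aE] := boolp.choice (fun j => surj_p (g (f j))).
  pose h (u : dual P) := \sum_i (u (e i) : S) *: a i.
  have h_lin : linear h.
    move=> c u v; rewrite /h scaler_sumr -big_split; apply: eq_bigr => j _ /=.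
    by rewrite scalerA -scalerDl.
  pose hL := GRing.isLinear.Build S (dual P) A *:%R h h_lin.
  exists (HB.pack h hL : {linear dual P -> A}) => u /=.
  rewrite {2}(dualE u) !linear_sum; apply: eq_bigr => j _.
  by rewrite !linearZ aE.
- pose inv (phi : dual (dual P)) : P :=
    \sum_i (phi (f i) : S) *: e i.
  exists inv => [x|phi]; first by rewrite [RHS]fE.
  apply: linear_ext => u; transitivity (u (inv phi)); first by [].
  rewrite [in RHS](dualE u) !linear_sum; apply: eq_bigr => j _.
  by rewrite !linearZ /=; exact: mulrC.
Qed.

End Modules.

Record preadditive := Preadditive {
  ob :> Type;
  hom : ob -> ob -> zmodType;
  idm : forall A, hom A A;
  ccomp : forall A B C, hom B C -> hom A B -> hom A C;
  compA : forall A B C D (h : hom C D) (g : hom B C) (f : hom A B),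
    ccomp h (ccomp g f) = ccomp (ccomp h g) f;
  comp1m : forall A B (f : hom A B), ccomp (idm B) f = f;
  compm1 : forall A B (f : hom A B), ccomp f (idm A) = f;
  compDl : forall A B C (g h : hom B C) (f : hom A B),
    ccomp (g + h) f = ccomp g f + ccomp h f;
  compDr : forall A B C (h : hom B C) (f g : hom A B),
    ccomp h (f + g) = ccomp h f + ccomp h g
}.
Arguments idm {_} A.
Notation "g ∘ f" := (ccomp g f) (at level 40, left associativity).

Section Categories.
Variable C : preadditive.
Implicit Types A B X Y Z : C.

Definition is_iso X Y (f : hom X Y) : Prop :=
  exists g : hom Y X, g ∘ f = idm X /\ f ∘ g = idm Y.

Definition is_zero_object Z : Prop :=
  forall A, (forall f : hom A Z, f = 0) /\ (forall f : hom Z A, f = 0).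

Definition is_biproduct X Y Z : Prop :=
  exists (i1 : hom X Z) (i2 : hom Y Z) (p1 : hom Z X) (p2 : hom Z Y),
    [/\ p1 ∘ i1 = idm X, p2 ∘ i2 = idm Y, p1 ∘ i2 = 0, p2 ∘ i1 = 0
      & i1 ∘ p1 + i2 ∘ p2 = idm Z].

Definition is_direct_sum (I : finType) (X : I -> C) Z : Prop :=
  exists (inj : forall k, hom (X k) Z) (prj : forall k, hom Z (X k)),
    [/\ forall k, prj k ∘ inj k = idm (X k),
        forall k l, k != l -> prj k ∘ inj l = 0
      & \sum_k inj k ∘ prj k = idm Z].

Definition is_direct_summand X Z : Prop := exists Y, is_biproduct X Y Z.

Definition additive_category : Prop :=
  (exists Z, is_zero_object Z) /\ forall X Y, exists Z, is_biproduct X Y Z.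

Definition is_kernel A B X (i : hom A B) (p : hom B X) : Prop :=
  p ∘ i = 0 /\
  forall Y (f : hom Y B), p ∘ f = 0 -> exists! g : hom Y A, i ∘ g = f.

Definition is_cokernel A B X (i : hom A B) (p : hom B X) : Prop :=
  p ∘ i = 0 /\
  forall Y (f : hom B Y), f ∘ i = 0 -> exists! g : hom X Y, g ∘ p = f.

(*   A --i--> B
     |f       |f'
     X --i'-> Y   *)
Definition is_pushout A B X Y (i : hom A B) (f : hom A X)
    (i' : hom X Y) (f' : hom B Y) : Prop :=
  i' ∘ f = f' ∘ i /\
  forall T (u : hom X T) (v : hom B T), u ∘ f = v ∘ i ->
    exists! t : hom Y T, t ∘ i' = u /\ t ∘ f' = v.

(*   Y --p'-> X
     |f'      |f
     B --p--> A   *)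
Definition is_pullback A B X Y (p : hom B A) (f : hom X A)
    (p' : hom Y X) (f' : hom Y B) : Prop :=
  f ∘ p' = p ∘ f' /\
  forall T (u : hom T X) (v : hom T B), f ∘ u = p ∘ v ->
    exists! t : hom T Y, p' ∘ t = u /\ f' ∘ t = v.

Variable xi : forall A B X, hom A B -> hom B X -> Prop.

Definition inflation A B (i : hom A B) : Prop :=
  exists X (p : hom B X), xi i p.

Definition deflation B X (p : hom B X) : Prop :=
  exists A (i : hom A B), xi i p.

Definition iso_closed : Prop :=
  forall A B X A' B' X' (i : hom A B) (p : hom B X)
    (i' : hom A' B') (p' : hom B' X')
    (a : hom A A') (b : hom B B') (x : hom X X'),
  is_iso a -> is_iso b -> is_iso x -> b ∘ i = i' ∘ a -> x ∘ p = p' ∘ b ->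
  xi i p -> xi i' p'.

(* The axioms of T. Buehler, Exact categories, Definition 2.1; they imply the
   remaining axiom of Quillen's original list (the "obscure" one). *)
Record exact_category : Prop := {
  ex_additive : additive_category;
  ex_kercoker : forall A B X (i : hom A B) (p : hom B X),
    xi i p -> is_kernel i p /\ is_cokernel i p;
  ex_iso_closed : iso_closed;
  ex_id_inflation : forall A, inflation (idm A);
  ex_id_deflation : forall A, deflation (idm A);
  ex_comp_inflation : forall A B X (i : hom A B) (j : hom B X),
    inflation i -> inflation j -> inflation (j ∘ i);
  ex_comp_deflation : forall A B X (p : hom A B) (q : hom B X),
    deflation p -> deflation q -> deflation (q ∘ p);
  ex_pushout : forall A B X (i : hom A B) (f : hom A X), inflation i ->
    exists Y (i' : hom X Y) (f' : hom B Y),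
      is_pushout i f i' f' /\ inflation i';
  ex_pullback : forall A B X (p : hom B A) (f : hom X A), deflation p ->
    exists Y (p' : hom Y X) (f' : hom Y B),
      is_pullback p f p' f' /\ deflation p'
}.

Definition projective_object X : Prop :=
  forall A B (p : hom A B) (f : hom X B), deflation p ->
    exists g : hom X A, p ∘ g = f.

Definition injective_object X : Prop :=
  forall A B (i : hom A B) (f : hom A X), inflation i ->
    exists g : hom B X, g ∘ i = f.

Definition enough_projectives : Prop :=
  forall X, exists P (p : hom P X), projective_object P /\ deflation p.

Definition enough_injectives : Prop :=
  forall X, exists Q (i : hom X Q), injective_object Q /\ inflation i.

Record frobenius_category : Prop := {
  frob_exact : exact_category;
  frob_enough_proj : enough_projectives;
  frob_enough_inj : enough_injectives;
  frob_proj_inj : forall X, projective_object X <-> injective_object X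
}.

End Categories.

Section MatrixFactorizations.
Variables (S : comNzRingType) (w : S).

Record mf_object := MFObject {
  mf1 : lmodType S;
  mf0 : lmodType S;
  mf_g1 : {linear mf1 -> mf0};
  mf_g0 : {linear mf0 -> mf1};
  mf_gproj1 : gorenstein_projective mf1;
  mf_gproj0 : gorenstein_projective mf0;
  mf_g1g0 : forall x, mf_g1 (mf_g0 x) = w *: x;
  mf_g0g1 : forall x, mf_g0 (mf_g1 x) = w *: x
}.

Record mf_hom (X Y : mf_object) := MFHom {
  mf_phi1 : {linear mf1 X -> mf1 Y};
  mf_phi0 : {linear mf0 X -> mf0 Y};
  mf_comm1 : forall x, mf_g1 Y (mf_phi1 x) = mf_phi0 (mf_g1 X x);
  mf_comm0 : forall x, mf_g0 Y (mf_phi0 x) = mf_phi1 (mf_g0 X x)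
}.

Lemma mf_hom_ext X Y (f g : mf_hom X Y) :
  mf_phi1 f = mf_phi1 g -> mf_phi0 f = mf_phi0 g -> f = g.
Proof.
case: f g => [f1 f0 c1 c0] [g1 g0 d1 d0] /= e1 e0.
rewrite e1 e0 in c1 c0 *.
by rewrite (Prop_irrelevance c1 d1) (Prop_irrelevance c0 d0).
Qed.

Section HomZmodule.
Variables X Y : mf_object.
Implicit Types f g : mf_hom X Y.

HB.instance Definition _ := gen_eqMixin (mf_hom X Y).
HB.instance Definition _ := gen_choiceMixin (mf_hom X Y).

Definition mf_zero : mf_hom X Y.
Proof. by exists 0 0 => x; rewrite !lin_zeroE linear0. Defined.

Definition mf_add f g : mf_hom X Y.
Proof.
exists (mf_phi1 f + mf_phi1 g) (mf_phi0 f + mf_phi0 g) => x.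
- by rewrite !lin_addE linearD !mf_comm1.
- by rewrite !lin_addE linearD !mf_comm0.
Defined.

Definition mf_opp f : mf_hom X Y.
Proof.
exists (- mf_phi1 f) (- mf_phi0 f) => x.
- by rewrite !lin_oppE linearN mf_comm1.
- by rewrite !lin_oppE linearN mf_comm0.
Defined.

Lemma mf_addA : associative mf_add.
Proof. by move=> f g h; apply: mf_hom_ext; exact: addrA. Qed.
Lemma mf_addC : commutative mf_add.
Proof. by move=> f g; apply: mf_hom_ext; exact: addrC. Qed.
Lemma mf_add0 : left_id mf_zero mf_add.
Proof. by move=> f; apply: mf_hom_ext; exact: add0r. Qed.
Lemma mf_addN : left_inverse mf_zero mf_opp mf_add.
Proof. by move=> f; apply: mf_hom_ext; exact: addNr. Qed.

HB.instance Definition _ :=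
  GRing.isZmodule.Build (mf_hom X Y) mf_addA mf_addC mf_add0 mf_addN.

End HomZmodule.

Definition mf_id X : mf_hom X X.
Proof. by exists idfun idfun. Defined.

Definition mf_comp X Y Z (g : mf_hom Y Z) (f : mf_hom X Y) : mf_hom X Z.
Proof.
exists (mf_phi1 g \o mf_phi1 f) (mf_phi0 g \o mf_phi0 f) => x /=.
- by rewrite !mf_comm1.
- by rewrite !mf_comm0.
Defined.

Definition MF : preadditive.
Proof.
refine (@Preadditive mf_object (fun X Y => mf_hom X Y) mf_id mf_comp
  _ _ _ _ _).
- by move=> *; apply: mf_hom_ext; exact: linear_ext.
- by move=> *; apply: mf_hom_ext; exact: linear_ext.
- by move=> *; apply: mf_hom_ext; exact: linear_ext.
- by move=> *; apply: mf_hom_ext; exact: linear_ext.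
- by move=> *; apply: mf_hom_ext; apply: linear_ext => x; exact: linearD.
Defined.

Definition short_exact (A B C : lmodType S)
    (i : {linear A -> B}) (p : {linear B -> C}) : Prop :=
  [/\ injective i, exact_at i p & surjective p].

Definition mf_ses (A B C : MF) (i : hom A B) (p : hom B C) : Prop :=
  short_exact (mf_phi1 i) (mf_phi1 p) /\ short_exact (mf_phi0 i) (mf_phi0 p).

(* (P --w--> P, P --id--> P) *)
Definition mf_w_id (P : lmodType S) (hP : fg_projective P) : MF :=
  @MFObject P P ( *:%R w) idfun
    (fg_projective_gorenstein hP) (fg_projective_gorenstein hP)
    (fun _ => erefl) (fun _ => erefl).

(* (Q --id--> Q, Q --w--> Q) *)
Definition mf_id_w (Q : lmodType S) (hQ : fg_projective Q) : MF :=
  @MFObject Q Q idfun ( *:%R w)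
    (fg_projective_gorenstein hQ) (fg_projective_gorenstein hQ)
    (fun _ => erefl) (fun _ => erefl).

Definition is_elementary (E : MF) : Prop :=
  exists (P Q : lmodType S) (hP : fg_projective P) (hQ : fg_projective Q),
    is_biproduct (mf_w_id hP) (mf_id_w hQ) E.

Definition summand_of_elementary (X : MF) : Prop :=
  exists (k : nat) (E : 'I_k -> MF) (Z : MF),
    [/\ forall j, is_elementary (E j), is_direct_sum E Z
      & is_direct_summand X Z].

End MatrixFactorizations.

(* Main.v *)
(* Ext^(n+1)(M, N) = 0 is handled without cohomology: Ext^1(M, N) = 0 says that
   maps into N extend along every short exact sequence ending in M, and higher
   vanishing is shifted to a syzygy.  Schanuel's lemma makes this agree with the
   vanishing computed from any projective resolution, and Gorenstein projective
   modules are then closed under extensions, under syzygies (dualize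
   0 -> K -> P -> G -> 0 twice and use the five lemma) and under duals.
   Dualizing a free cover of G^* embeds G in a finitely generated projective
   with Gorenstein projective cokernel.  The exact structure on MF is therefore
   computed componentwise: every kernel or cokernel that occurs is an extension
   of Gorenstein projectives.
   Maps out of (P -w-> P, P -1-> P) are maps P -> X_0 and maps into it are maps
   X_1 -> P; as Ext^1(G, P) = 0 for G Gorenstein projective, it is both
   projective and injective.  Covers and embeddings of the two components of X
   assemble to a deflation from an elementary object onto X and an inflation of
   X into one, and these split when X is projective, respectively injective. *)

From HB Require Import structures.
From mathcomp Require Import all_boot all_algebra.
From mathcomp Require Import boolp.
Require Import Defs.

Set Implicit Arguments.
Unset Strict Implicit.
Unset Printing Implicit Defensive.

Import GRing.Theory.
Local Open Scope ring_scope.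

(** * Kernel and cokernel modules *)

Definition mklin (S : pzRingType) (U V : lmodType S) (f : U -> V)
    (f_lin : linear f) : {linear U -> V} :=
  HB.pack f (GRing.isLinear.Build S U V *:%R f f_lin).

Section KernelModule.
Variables (S : pzRingType) (U V : lmodType S) (f : {linear U -> V}).

Definition in_ker : {pred U} := fun x => f x == 0.

Fact in_ker_submod_closed : submod_closed in_ker.
Proof.
split=> [|a x y /eqP fx /eqP fy]; first by rewrite unfold_in linear0.
by rewrite unfold_in linearP fx fy scaler0 addr0.
Qed.
HB.instance Definition _ :=
  GRing.isSubmodClosed.Build S U in_ker in_ker_submod_closed.

Record ker_mod := KerMod { ker_val :> U; ker_valP : ker_val \in in_ker }.
HB.instance Definition _ := [isSub for ker_val].
HB.instance Definition _ := [Choice of ker_mod by <:].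
HB.instance Definition _ := [SubChoice_isSubLmodule of ker_mod by <:].

Lemma kernel_exists :
  exists (K : lmodType S) (i : {linear K -> U}), injective i /\ exact_at i f.
Proof.
exists ker_mod, (mklin (linearP (\val : ker_mod -> U))).
split=> [|y]; first exact: val_inj.
split=> [/eqP fy|[x <-]]; first by exists (KerMod fy).
exact/eqP/ker_valP.
Qed.

End KernelModule.

Section CokernelModule.
Variables (S : pzRingType) (U V : lmodType S) (f : {linear U -> V}).

(** The image is made a boolean predicate by classical decidability, the form in which the quotient
    construction takes its subgroup. *)
Definition in_im : {pred V} := fun y => `[< exists x, f x = y >].

Fact in_imP y : reflect (exists x, f x = y) (y \in in_im).
Proof. exact: asboolP. Qed.

Fact in_im_submod_closed : submod_closed in_im.
Proof.
split=> [|a _ _ /in_imP[x <-] /in_imP[y <-]]; apply/in_imP.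
  by exists 0; rewrite linear0.
by exists (a *: x + y); rewrite linearP.
Qed.
HB.instance Definition _ :=
  GRing.isSubmodClosed.Build S V in_im in_im_submod_closed.

Definition coker_mod := Quotient.quot (in_im : zmodClosed V).
HB.instance Definition _ := GRing.Zmodule.on coker_mod.

Local Notation pi := (\pi_coker_mod%qT : V -> coker_mod).

(** The quotient is only an additive group at this point, so scalars act through representatives;
    [coker_scaleE] shows independence of the representative, because the image is stable under
    scalars. *)
Definition coker_scale (a : S) (x : coker_mod) : coker_mod := pi (a *: repr x).

Fact coker_piE (x y : V) : (pi x = pi y) <-> (x - y \in in_im).
Proof.
by rewrite Quotient.idealrBE; split=> [xy|/eqP //]; apply/eqP.
Qed.

Fact coker_scaleE a x : coker_scale a (pi x) = pi (a *: x).
Proof.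
apply/coker_piE; rewrite -scalerBr rpredZ //.
by apply/coker_piE; rewrite reprK.
Qed.

Fact coker_scaleA a b x :
  coker_scale a (coker_scale b x) = coker_scale (a * b) x.
Proof.
by elim/quotW: x => x; rewrite (coker_scaleE b) !coker_scaleE scalerA.
Qed.
Fact coker_scale1 : left_id 1 coker_scale.
Proof. by elim/quotW=> x; rewrite coker_scaleE scale1r. Qed.
Fact coker_scaleDr : right_distributive coker_scale +%R.
Proof.
move=> a; elim/quotW=> x; elim/quotW=> y.
by rewrite -raddfD !coker_scaleE scalerDr raddfD.
Qed.
Fact coker_scaleDl x : {morph coker_scale^~ x : a b / a + b}.
Proof.
by move=> a b; elim/quotW: x => x; rewrite !coker_scaleE scalerDl raddfD.
Qed.
HB.instance Definition _ := GRing.Zmodule_isLmodule.Build S coker_mod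
  coker_scaleA coker_scale1 coker_scaleDr coker_scaleDl.

Fact coker_pi_linear : linear pi.
Proof.
move=> a x y; rewrite [LHS]raddfD; congr (_ + _).
exact/esym/coker_scaleE.
Qed.

Lemma cokernel_exists :
  exists (C : lmodType S) (q : {linear V -> C}), surjective q /\ exact_at f q.
Proof.
exists coker_mod, (mklin coker_pi_linear); split=> [y|y].
  by exists (repr y); exact: reprK.
have -> : mklin coker_pi_linear y = 0 <-> pi y = pi 0 by rewrite raddf0.
by rewrite coker_piE subr0; split=> /in_imP.
Qed.

End CokernelModule.

(** * Linear maps, short exact sequences, pullbacks and pushouts of modules *)

Section LinearMaps.
Variable S : comNzRingType.
Implicit Types U V W A B C D E K L T X Z : lmodType S.

Fact pair_lin_linear U V W (f : {linear U -> V}) (g : {linear U -> W}) :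
  linear (fun x => (f x, g x)).
Proof. by move=> a x y; rewrite !linearP. Qed.

Definition pair_lin U V W (f : {linear U -> V}) (g : {linear U -> W}) :
  {linear U -> (V * W)%type} := mklin (pair_lin_linear f g).

Definition copair_lin U V W (f : {linear U -> W}) (g : {linear V -> W}) :
  {linear (U * V)%type -> W} :=
  (f \o fst : {linear (U * V)%type -> W}) +
  (g \o snd : {linear (U * V)%type -> W}).

Lemma copair_linE U V W (f : {linear U -> W}) (g : {linear V -> W}) x :
  copair_lin f g x = f x.1 + g x.2.
Proof. by []. Qed.

(** Preimages under [i] are chosen pointwise; injectivity of [i] makes them unique and the choice
    linear. *)
Lemma factor_inj U V K (i : {linear K -> V}) (f : {linear U -> V}) :
  injective i -> (forall x, exists k, i k = f x) ->
  exists g : {linear U -> K}, forall x, i (g x) = f x.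
Proof.
move=> inj_i /boolp.choice[g gE].
have g_lin : linear g.
  by move=> a x y; apply: inj_i; rewrite linearP !gE linearP.
by exists (mklin g_lin).
Qed.

(** With a set-theoretic section [s] of [q], the composite [f \o s] is linear because [f] kills the
    kernel of [q] and so does not see the choices made by [s]. *)
Lemma factor_surj U V W (q : {linear U -> V}) (f : {linear U -> W}) :
  surjective q -> (forall x, q x = 0 -> f x = 0) ->
  exists g : {linear V -> W}, forall x, g (q x) = f x.
Proof.
move=> /boolp.choice[s sE] kerf.
have gE x : f (s (q x)) = f x.
  by apply/eqP; rewrite -subr_eq0 -linearB kerf // linearB /= sE subrr.
have g_lin : linear (f \o s).
  move=> a x y; rewrite /= -linearP -[in LHS](sE x) -[in LHS](sE y).
  by rewrite -linearP gE.
by exists (mklin g_lin).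
Qed.

Lemma linear_inj0 U V (f : {linear U -> V}) :
  (forall x, f x = 0 -> x = 0) -> injective f.
Proof. exact: raddf_inj. Qed.

Lemma surj_cancel (U V : Type) W (q : U -> V) (f g : V -> W) :
  surjective q -> (forall x, f (q x) = g (q x)) -> forall y, f y = g y.
Proof. by move=> qs fg y; have [x <-] := qs y. Qed.

Section ShortExact.
Variables (A B C : lmodType S) (i : {linear A -> B}) (p : {linear B -> C}).
Hypothesis ip : short_exact i p.

Lemma ses_inj : injective i. Proof. by case: ip. Qed.
Lemma ses_surj : surjective p. Proof. by case: ip. Qed.
Lemma ses_ker y : p y = 0 -> exists x, i x = y.
Proof. by case: ip => _ ex _ /ex. Qed.
Lemma ses_comp x : p (i x) = 0.
Proof. by case: ip => _ ex _; apply/ex; exists x. Qed.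
Lemma ses_inj0 x : i x = 0 -> x = 0.
Proof. by move=> ix; apply: ses_inj; rewrite ix linear0. Qed.

Lemma ses_lift U (f : {linear U -> B}) : (forall x, p (f x) = 0) ->
  exists g : {linear U -> A}, forall x, i (g x) = f x.
Proof. by move=> pf; apply: (factor_inj ses_inj) => x; exact: ses_ker. Qed.

Lemma ses_desc W (f : {linear B -> W}) : (forall x, f (i x) = 0) ->
  exists g : {linear C -> W}, forall x, g (p x) = f x.
Proof.
by move=> fi; apply: (factor_surj ses_surj) => x /ses_ker[y <-].
Qed.

End ShortExact.

Lemma pair_ses A B :
  short_exact (pair_lin idfun 0 : {linear A -> (A * B)%type}) snd.
Proof.
split=> [x y []//|[x y]|y]; last by exists (0, y).
by split=> [/= ->|[z [_ <-]] //]; exists x.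
Qed.

Lemma surj_ses U V (f : {linear U -> V}) : surjective f ->
  exists K (i : {linear K -> U}), short_exact i f.
Proof. by move=> sf; have [K [i [ii ie]]] := kernel_exists f; exists K, i. Qed.

Lemma inj_ses U V (f : {linear U -> V}) : injective f ->
  exists C (q : {linear V -> C}), short_exact f q.
Proof.
by move=> jf; have [C [q [qs qe]]] := cokernel_exists f; exists C, q.
Qed.

(** Snake lemma for [p \o q]: its kernel [L] maps onto the kernel [A] of [p] by restricting [q].
    With [gp_ext] this makes deflations compose. *)
Lemma kernel_comp_ses A B C K L X (i : {linear A -> B}) (p : {linear B -> C})
    (j : {linear X -> K}) (q : {linear K -> B}) (k : {linear L -> K}) :
  short_exact i p -> short_exact j q -> short_exact k (p \o q) ->
  exists (j' : {linear X -> L}) (q' : {linear L -> A}),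
    [/\ short_exact j' q', forall x, k (j' x) = j x
      & forall x, i (q' x) = q (k x)].
Proof.
move=> ip jq kpq.
have [|j' j'E] := ses_lift kpq (f := j).
  by move=> x; rewrite /= (ses_comp jq) linear0.
have [|q' q'E] := ses_lift ip (f := q \o k); first exact: (ses_comp kpq).
exists j', q'; split=> //; split=> [x y e|y|y].
- by apply: (ses_inj jq); rewrite -!j'E e.
- split=> [q'y|[x <-]]; last first.
    by apply: (ses_inj0 ip); rewrite q'E /= j'E (ses_comp jq).
  have [|x xE] := ses_ker jq (y := k y); first by rewrite -[LHS]q'E q'y linear0.
  by exists x; apply: (ses_inj kpq); rewrite j'E.
- have [x xE] := ses_surj jq (i y).
  have [|z zE] := ses_ker kpq (y := x); first by rewrite /= xE (ses_comp ip).
  by exists z; apply: (ses_inj ip); rewrite q'E /= zE.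
Qed.

(** Dual to [kernel_comp_ses]: the cokernel [E] of [j \o i] is filtered by the cokernels of [i] and
    [j]. *)
Lemma cokernel_comp_ses A B C X D E (i : {linear A -> B}) (p : {linear B -> C})
    (j : {linear B -> X}) (q : {linear X -> D}) (r : {linear X -> E}) :
  short_exact i p -> short_exact j q -> short_exact (j \o i) r ->
  exists (u : {linear C -> E}) (v : {linear E -> D}), short_exact u v.
Proof.
move=> ip jq jir.
have [|u uE] := ses_desc ip (f := r \o j); first exact: (ses_comp jir).
have [|v vE] := ses_desc jir (f := q).
  by move=> x; rewrite /= (ses_comp jq).
exists u, v; split=> [|e|d].
- apply: linear_inj0 => c; have [b <-] := ses_surj ip c.
  rewrite uE => /(ses_ker jir)[a /(ses_inj jq)<-].
  exact: (ses_comp ip).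
- split=> [|[c <-]].
    have [x <-] := ses_surj jir e; rewrite vE => /(ses_ker jq)[b <-].
    by exists (p b); rewrite uE.
  by have [b <-] := ses_surj ip c; rewrite uE vE (ses_comp jq).
- by have [x <-] := ses_surj jq d; exists (r x); rewrite vE.
Qed.

(** Pullbacks described on elements; the last clause says that [p'] and [f'] are jointly injective.
    The universal property is recovered in [mod_pullback_lift]. *)
Definition mod_pullback A B X Z (p : {linear B -> A}) (f : {linear X -> A})
    (p' : {linear Z -> X}) (f' : {linear Z -> B}) : Prop :=
  [/\ forall z, f (p' z) = p (f' z),
      forall x b, f x = p b -> exists2 z, p' z = x & f' z = b
    & forall z, p' z = 0 -> f' z = 0 -> z = 0].

Lemma mod_pullback_exists A B X (p : {linear B -> A}) (f : {linear X -> A}) :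
  exists Z (p' : {linear Z -> X}) (f' : {linear Z -> B}),
    mod_pullback p f p' f'.
Proof.
pose d := copair_lin f (- p); have dE x : d x = f x.1 - p x.2 by [].
have [Z [k [ki ke]]] := kernel_exists d.
exists Z, (fst \o k), (snd \o k); split=> [z|x b|z /= z1 z2].
- by apply/eqP; rewrite -subr_eq0 -dE; apply/eqP/ke; exists z.
- move=> fp; have [|z zE] := (ke (x, b)).1; first by rewrite dE fp subrr.
  by exists z; rewrite /= zE.
- by apply: ki; rewrite linear0 [LHS]surjective_pairing z1 z2.
Qed.

Section Pullback.
Variables (A B X Z : lmodType S) (p : {linear B -> A}) (f : {linear X -> A}).
Variables (p' : {linear Z -> X}) (f' : {linear Z -> B}).
Hypothesis pb : mod_pullback p f p' f'.

Lemma mod_pullback_sym : mod_pullback f p f' p'.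
Proof.
case: pb => comm lift inj0; split=> // [x b /esym/lift[z]|z z1 z2].
  by exists z.
exact: inj0.
Qed.

Lemma mod_pullback_inj z z' : p' z = p' z' -> f' z = f' z' -> z = z'.
Proof.
case: pb => _ _ inj0 e1 e2; apply/eqP; rewrite -subr_eq0; apply/eqP/inj0.
  by rewrite linearB e1 subrr.
by rewrite linearB e2 subrr.
Qed.

Lemma mod_pullback_lift T (u : {linear T -> X}) (v : {linear T -> B}) :
  (forall x, f (u x) = p (v x)) ->
  exists t : {linear T -> Z},
    (forall x, p' (t x) = u x) /\ (forall x, f' (t x) = v x).
Proof.
case: pb => _ lift _ fp.
have [||t tE] := factor_inj (i := pair_lin p' f') (f := pair_lin u v).
- by move=> z z' [/mod_pullback_inj]; apply.
- by move=> x; have [z z1 z2] := lift _ _ (fp x); exists z; rewrite /= z1 z2.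
by exists t; split=> x; have [] := tE x.
Qed.

Lemma mod_pullback_ses C (i : {linear C -> B}) (i' : {linear C -> Z}) :
  short_exact i p -> (forall c, p' (i' c) = 0) -> (forall c, f' (i' c) = i c) ->
  short_exact i' p'.
Proof.
case: pb => comm lift _ ip i'1 i'2; split=> [c d e|z|x].
- by apply: (ses_inj ip); rewrite -!i'2 e.
- split=> [z0|[c <-]] //.
  have [|c cE] := ses_ker ip (y := f' z); first by rewrite -comm z0 linear0.
  by exists c; apply: mod_pullback_inj; rewrite ?i'1 ?z0 ?i'2 ?cE.
- have [b /esym/lift[z z1 _]] := ses_surj ip (f x); by exists z.
Qed.

Lemma mod_pullback_ses_exists C (i : {linear C -> B}) :
  short_exact i p -> exists i' : {linear C -> Z}, short_exact i' p'.
Proof.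
move=> ip; have [|i' [i'1 i'2]] := mod_pullback_lift (u := 0) (v := i).
  by move=> x; rewrite (ses_comp ip) linear0.
by exists i'; exact: mod_pullback_ses i'1 i'2.
Qed.

End Pullback.

(** The clauses present [Z] as the cokernel of the map with components [f] and [- i] from [A] to the
    product of [X] and [B]. *)
Definition mod_pushout A B X Z (i : {linear A -> B}) (f : {linear A -> X})
    (i' : {linear X -> Z}) (f' : {linear B -> Z}) : Prop :=
  [/\ forall a, i' (f a) = f' (i a),
      forall z, exists x b, z = i' x + f' b
    & forall x b, i' x + f' b = 0 -> exists2 a, f a = x & i a = - b].

Lemma mod_pushout_exists A B X (i : {linear A -> B}) (f : {linear A -> X}) :
  exists Z (i' : {linear X -> Z}) (f' : {linear B -> Z}), mod_pushout i f i' f'.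
Proof.
have [Z [q [qs qe]]] := cokernel_exists (pair_lin f (- i)).
have qE x b : q (x, 0) + q (0, b) = q (x, b).
  by rewrite -linearD; congr (q (_, _)); rewrite ?addr0 ?add0r.
exists Z, (q \o pair_lin idfun 0), (q \o pair_lin 0 idfun).
split=> [a|z|x b] /=.
- apply/eqP; rewrite -subr_eq0 -linearB; apply/eqP/qe; exists a.
  by congr (_, _); rewrite /= ?subr0 ?sub0r.
- by have [[x b] <-] := qs z; exists x, b; rewrite qE.
- by rewrite qE => /qe[a [<- <-]]; exists a; rewrite ?opprK.
Qed.

Section Pushout.
Variables (A B X Z : lmodType S) (i : {linear A -> B}) (f : {linear A -> X}).
Variables (i' : {linear X -> Z}) (f' : {linear B -> Z}).
Hypothesis po : mod_pushout i f i' f'.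

Lemma mod_pushout_ext (T : lmodType S) (u v : {linear Z -> T}) :
  (forall x, u (i' x) = v (i' x)) -> (forall b, u (f' b) = v (f' b)) ->
  forall z, u z = v z.
Proof.
case: po => _ gen _ e1 e2 z; have [x [b ->]] := gen z.
by rewrite !linearD e1 e2.
Qed.

Lemma mod_pushout_desc T (u : {linear X -> T}) (v : {linear B -> T}) :
  (forall a, u (f a) = v (i a)) ->
  exists t : {linear Z -> T},
    (forall x, t (i' x) = u x) /\ (forall b, t (f' b) = v b).
Proof.
case: po => _ gen ker uv.
have [||t tE] := factor_surj (q := copair_lin i' f') (f := copair_lin u v).
- by move=> z; have [x [b ->]] := gen z; exists (x, b).
- move=> [x b]; rewrite !copair_linE => /ker[a <- ia].
  by rewrite uv -linearD ia addNr linear0.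
exists t; split=> [x|b].
  by have:= tE (x, 0); rewrite !copair_linE /= !linear0 !addr0.
by have:= tE (0, b); rewrite !copair_linE /= !linear0 !add0r.
Qed.

Lemma mod_pushout_ses C (p : {linear B -> C}) (p' : {linear Z -> C}) :
  short_exact i p -> (forall x, p' (i' x) = 0) -> (forall b, p' (f' b) = p b) ->
  short_exact i' p'.
Proof.
case: po => comm gen ker ip p'1 p'2; split=> [|z|c].
- apply: linear_inj0 => x ix; have [|a <-] := ker x 0.
    by rewrite ix linear0 addr0.
  by rewrite oppr0 => /(ses_inj0 ip)->; rewrite linear0.
- split=> [|[x <-]] //; have [x [b ->]] := gen z.
  rewrite linearD p'1 p'2 add0r => /(ses_ker ip)[a <-].
  by exists (x + f a); rewrite linearD comm.
- by have [b <-] := ses_surj ip c; exists (f' b).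
Qed.

Lemma mod_pushout_ses_exists C (p : {linear B -> C}) :
  short_exact i p -> exists p' : {linear Z -> C}, short_exact i' p'.
Proof.
move=> ip; have [|p' [p'1 p'2]] := mod_pushout_desc (u := 0) (v := p).
  by move=> x; rewrite (ses_comp ip).
by exists p'; exact: mod_pushout_ses p'1 p'2.
Qed.

End Pushout.

End LinearMaps.

(** * Finitely generated projective modules *)

Section Projectives.
Variable S : comNzRingType.
Implicit Types A B C K M N P Q : lmodType S.

Lemma projective_retract P Q (r : {linear P -> Q}) (s : {linear Q -> P}) :
  (forall x, r (s x) = x) -> projective P -> projective Q.
Proof.
move=> rs projP A B p f ps; have [g gE] := projP _ _ p (f \o r) ps.
by exists (g \o s) => x; rewrite /= gE /= rs.
Qed.

Lemma ses_projective_split A B P (i : {linear A -> B}) (p : {linear B -> P}) :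
  short_exact i p -> projective P ->
  exists (s : {linear P -> B}) (r : {linear B -> A}),
    [/\ forall x, p (s x) = x, forall x, r (i x) = x, forall x, r (s x) = 0
      & forall x, i (r x) = x - s (p x)].
Proof.
move=> ip /(_ _ _ p idfun (ses_surj ip))[s sE].
have [|r rE] := ses_lift ip
    (f := (idfun : {linear B -> B}) - (s \o p : {linear B -> B})).
  by move=> x; rewrite /= linearB /= sE subrr.
exists s, r; split=> // x; apply: (ses_inj ip); rewrite rE /=.
  by rewrite (ses_comp ip) linear0 subr0.
by rewrite sE subrr linear0.
Qed.

Lemma projective_pair P Q :
  projective P -> projective Q -> projective (P * Q)%type.
Proof.
move=> projP projQ A B p f ps.
have [g gE] := projP _ _ p (f \o pair_lin idfun 0) ps.
have [h hE] := projQ _ _ p (f \o pair_lin 0 idfun) ps.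
exists (copair_lin g h) => -[x y].
rewrite copair_linE linearD gE hE /= -linearD.
by congr (f (_, _)); rewrite ?addr0 ?add0r.
Qed.

Lemma fin_genP M : fin_gen M <->
  exists (I : finType) (e : I -> M), forall x, exists c : I -> S,
    x = \sum_i c i *: e i.
Proof.
split=> [[k [e eE]]|[I [e eE]]]; first by exists 'I_k, e.
exists #|I|, (e \o enum_val) => x; have [c ->] := eE x.
exists (c \o enum_val); rewrite (reindex (@enum_val I I)) //.
by apply: onW_bij; exact: enum_val_bij.
Qed.

(** Generators of the image are given as values [f (a j)], so that the lemma also serves a
    functional whose image is a proper ideal. *)
Lemma fin_gen_kernel_image K N C (i : {linear K -> N}) (f : {linear N -> C}) :
  exact_at i f -> fin_gen K ->
  (exists (k : nat) (a : 'I_k -> N), forall x, exists c : 'I_k -> S,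
    f x = \sum_j c j *: f (a j)) ->
  fin_gen N.
Proof.
move=> ie [l [e eE]] [k [a aE]]; apply/fin_genP.
exists ('I_l + 'I_k)%type.
exists (fun t => match t with inl u => i (e u) | inr v => a v end) => x.
have [c cE] := aE x.
have [|y yE] := (ie (x - \sum_j c j *: a j)).1.
  rewrite linearB linear_sum cE -sumrB big1 // => j _.
  by rewrite linearZ subrr.
have [d dE] := eE y.
exists (fun t => match t with inl u => d u | inr v => c v end).
rewrite big_sumType /= -[LHS](subrK (\sum_j c j *: a j)) -yE dE linear_sum.
by congr (_ + _); apply: eq_bigr => j _; rewrite linearZ.
Qed.

Lemma fin_gen_ses A B C (i : {linear A -> B}) (p : {linear B -> C}) :
  short_exact i p -> fin_gen A -> fin_gen C -> fin_gen B.
Proof.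
move=> ip fA [k [e eE]]; have [_ ex _] := ip.
apply: (fin_gen_kernel_image ex) => //.
have [s sE] := boolp.choice (fun j => ses_surj ip (e j)).
exists k, s => x; have [c ->] := eE (p x); exists c.
by apply: eq_bigr => j _; rewrite sE.
Qed.

(** Dual basis criterion. Conversely to [dual_basis], a lift of [g] is obtained by choosing
    preimages of the [g (e j)] and weighting them with the coordinates [f j]. *)
Lemma fg_projectiveP P : fg_projective P <->
  exists (I : finType) (e : I -> P) (f : I -> {linear P -> S^o}),
    forall x, x = \sum_i (f i x : S) *: e i.
Proof.
split=> [/dual_basis[k [e [f fE]]]|[I [e [f fE]]]]; first by exists 'I_k, e, f.
split.
  by apply/fin_genP; exists I, e => x; exists (fun i => f i x); exact: fE.
move=> A B p g ps.
have [a aE] := boolp.choice (fun j => ps (g (e j))).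
have h_lin : linear (fun x => \sum_j (f j x : S) *: a j).
  move=> c x y; rewrite scaler_sumr -big_split; apply: eq_bigr => j _ /=.
  by rewrite linearP scalerDl scalerA.
exists (mklin h_lin) => x /=.
rewrite [in RHS](fE x) !linear_sum; apply: eq_bigr => j _.
by rewrite !linearZ aE.
Qed.

Lemma fg_projective_row k : fg_projective ('rV[S]_k : lmodType S).
Proof.
have f_lin (j : 'I_k) : linear (fun x : 'rV[S]_k => x 0 j : S^o).
  by move=> a x y; rewrite !mxE.
apply/fg_projectiveP; exists 'I_k, (fun j => delta_mx 0 j).
exists (fun j => mklin (f_lin j)).
by move=> x; rewrite [LHS]row_sum_delta.
Qed.

(** The coordinate functionals generate the dual with the evaluations at the [e j] as coefficients:
    the two halves of a dual basis trade places. *)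
Lemma fg_projective_dual P :
  fg_projective P -> fg_projective ({linear P -> S^o} : lmodType S).
Proof.
move=> /fg_projectiveP[I [e [f fE]]]; apply/fg_projectiveP.
exists I, f, (fun j => biduality (e j)) => g.
apply: linear_ext => x; rewrite lin_sumE {1}(fE x) linear_sum.
by apply: eq_bigr => i _; rewrite linearZ; exact: mulrC.
Qed.

Lemma fg_projective_pair P Q :
  fg_projective P -> fg_projective Q -> fg_projective (P * Q)%type.
Proof.
move=> [fP pP] [fQ pQ]; split; last exact: projective_pair.
exact: fin_gen_ses (pair_ses P Q) fP fQ.
Qed.

Lemma free_cover M : fin_gen M ->
  exists (k : nat) (p : {linear 'rV[S]_k -> M}), surjective p.
Proof.
move=> [k [e eE]].
have p_lin : linear (fun v : 'rV[S]_k => \sum_i v 0 i *: e i).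
  move=> a u v; rewrite scaler_sumr -big_split; apply: eq_bigr => i _ /=.
  by rewrite !mxE scalerDl scalerA.
exists k, (mklin p_lin) => x; have [c ->] := eE x; exists (\row_i c i).
by apply: eq_bigr => i _; rewrite mxE.
Qed.

Lemma fg_projective_inj P : fg_projective P ->
  exists (k : nat) (f : {linear P -> 'rV[S]_k}), injective f.
Proof.
move=> /dual_basis[k [e [f fE]]].
have g_lin : linear (fun x => \row_j (f j x : S)).
  by move=> a x y; apply/rowP=> j; rewrite !mxE linearP.
exists k, (mklin g_lin); apply: linear_inj0 => x /rowP fx.
rewrite (fE x) big1 // => j _; have:= fx j; rewrite !mxE => ->.
exact: scale0r.
Qed.

(** * Finite generation over a noetherian ring *)

Section Noetherian.
Hypothesis noethS : noetherian S.

Lemma noetherian_functional N (f : {linear N -> S^o}) :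
  exists (k : nat) (a : 'I_k -> N), forall x, exists c : 'I_k -> S,
    f x = \sum_j c j *: f (a j).
Proof.
(* [noetherian] speaks of proper ideals; if the image of [f] contains 1, a preimage of 1 is a single
   generator. *)
have [[u fu]|no1] := pselect (exists u, f u = 1).
  exists 1, (fun=> u) => x; exists (fun=> f x).
  by rewrite big_ord1 fu; exact/esym/mulr1.
pose I : {pred S} := in_im f.
have [|k [a aE]] := noethS (I := I).
  split; first exact: rpred0.
    by apply/negP => /in_imP[u fu]; apply: no1; exists u.
  by move=> c x y Ix Iy; exact: (in_im_submod_closed f).2.
(* Each generator [a j] lies in the ideal, being the combination with Kronecker coefficients. *)
have /boolp.choice[b bE] j : exists y, f y = a j.
  apply/in_imP/aE; exists (fun l => (l == j)%:R).
  rewrite (bigD1 j) //= eqxx mul1r big1 ?addr0 // => l /negPf->.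
  by rewrite mul0r.
exists k, b => x; have [|c cE] := (aE (f x)).1; first by apply/in_imP; exists x.
by exists c; rewrite cE; apply: eq_bigr => j _; rewrite bE.
Qed.

(** Induction on the number of coordinates: the first coordinate is a functional with finitely
    generated image, and its kernel embeds through the remaining [k] coordinates. *)
Lemma noetherian_row k N (f : {linear N -> 'rV[S]_k}) :
  injective f -> fin_gen N.
Proof.
elim: k N f => [|k IHk] N f inj_f.
  exists 0%N, (fun=> 0) => x; exists (fun=> 0); rewrite big_ord0.
  by apply: inj_f; apply/rowP; case.
have g_lin : linear (fun x => f x 0 ord0 : S^o).
  by move=> a x y; rewrite linearP !mxE.
pose g := mklin g_lin.
have [K [i [inj_i ie]]] := kernel_exists g.
apply: (fin_gen_kernel_image ie); last exact: noetherian_functional.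
have h_lin : linear (fun x => \row_j f (i x) 0 (lift ord0 j)).
  by move=> a x y; apply/rowP=> j; rewrite !mxE !linearP !mxE.
apply: (IHk _ (mklin h_lin)); apply: linear_inj0 => x /rowP hx.
apply: inj_i; apply: inj_f; rewrite !linear0; apply/rowP=> j.
rewrite mxE; have [j' ->|->] := unliftP ord0 j.
  by have:= hx j'; rewrite !mxE.
by apply/ie; exists x.
Qed.

Lemma fin_gen_sub_projective K P (i : {linear K -> P}) :
  fg_projective P -> injective i -> fin_gen K.
Proof.
move=> /fg_projective_inj[k [f inj_f]] inj_i.
by apply: (@noetherian_row k _ (f \o i)); exact: inj_comp.
Qed.

(** A functional is determined by its values on generators, which embeds the dual in a free module
    of finite rank. *)
Lemma fin_gen_dual M : fin_gen M -> fin_gen ({linear M -> S^o} : lmodType S).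
Proof.
move=> [k [e eE]].
have h_lin : linear (fun u : {linear M -> S^o} => \row_j (u (e j) : S)).
  by move=> a x y; apply/rowP=> j; rewrite !mxE.
apply: (@noetherian_row k _ (mklin h_lin)); apply: linear_inj0 => u /rowP hu.
apply: linear_ext => x; have [c ->] := eE x; rewrite linear_sum big1 // => j _.
by rewrite linearZ; have:= hu j; rewrite !mxE => ->; exact: mulr0.
Qed.

End Noetherian.
End Projectives.

(** * Vanishing of Ext *)

Section ExtVanishing.
Variables (S : comNzRingType) (N : lmodType S).
Implicit Types A B C K L M P Q R : lmodType S.

(* [ext0 n M] stands for Ext^(n+1)(M, N) = 0; this form does not mention
   resolutions, so their independence reduces to Schanuel's lemma. *)
Fixpoint ext0 (n : nat) (M : lmodType S) : Prop :=
  match n with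
  | 0 => forall (A B : lmodType S) (i : {linear A -> B}) (p : {linear B -> M}),
      short_exact i p -> forall f : {linear A -> N},
      exists g : {linear B -> N}, forall x, g (i x) = f x
  | m.+1 =>
      exists (K P : lmodType S) (i : {linear K -> P}) (p : {linear P -> M}),
      [/\ projective P, short_exact i p & ext0 m K]
  end.

Lemma ext0_projective n P : projective P -> ext0 n P.
Proof.
elim: n P => [|n IHn] P projP /=.
  move=> A B i p ip f; have [s [r [_ ri _ _]]] := ses_projective_split ip projP.
  by exists (f \o r) => x; rewrite /= ri.
have [K [i ip]] := surj_ses (f := (idfun : {linear P -> P}))
  (fun x => ex_intro _ x erefl).
exists K, P, i, idfun; split=> //; apply: IHn => A B p f ps.
have K0 x : x = 0 :> K by apply: (ses_inj0 ip); exact: (ses_comp ip x).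
by exists 0 => x; rewrite (K0 x) !linear0.
Qed.

(** An extension [B] of [M] by [A] is the pushout of [P] along the map [k] from [K] to [A] induced
    by a lift [l] of [p]. Hence [f] extends from [A] to [B] as soon as [f \o k] extends from [K] to
    [P]. *)
Lemma ext0_presentation K P M (i : {linear K -> P}) (p : {linear P -> M}) :
  projective P -> short_exact i p ->
  (forall f : {linear K -> N}, exists g : {linear P -> N},
    forall x, g (i x) = f x) ->
  ext0 0 M.
Proof.
move=> projP ip extP A B j q jq f.
have [l lE] := projP _ _ q p (ses_surj jq).
have [|k kE] := ses_lift jq (f := l \o i).
  by move=> x; rewrite /= lE (ses_comp ip).
have [h hE] := extP (f \o k).
have [||g gE] := factor_surj (q := copair_lin j l) (f := copair_lin f h).
- move=> y; have [x xE] := ses_surj ip (q y).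
  have [|a aE] := ses_ker jq (y := y - l x).
    by rewrite linearB lE xE subrr.
  by exists (a, x); rewrite copair_linE /= aE subrK.
- move=> -[a x]; rewrite !copair_linE /= => ax.
  have [|y yE] := ses_ker ip (y := x).
    by rewrite -lE -(linear0 q) -ax linearD (ses_comp jq) add0r.
  move: ax; rewrite -yE hE /= -[l _]kE -linearD -linearD => /(ses_inj0 jq)->.
  exact: linear0.
by exists g => x; have:= gE (x, 0); rewrite !copair_linE /= !linear0 !addr0.
Qed.

(** In degree 0 a map extends in two stages: first to the kernel of [p \o q], an extension of [A],
    then to the whole module, an extension of [C]. *)
Lemma ext0_ext n A B C (i : {linear A -> B}) (p : {linear B -> C}) :
  short_exact i p -> ext0 n A -> ext0 n C -> ext0 n B.
Proof.
elim: n A B C i p => [|n IHn] A B C i p ip.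
  move=> extA extC X Y j q jq f.
  have pqs : surjective (p \o q).
    move=> z; have [y yE] := ses_surj ip z; have [x xE] := ses_surj jq y.
    by exists x; rewrite /= xE.
  have [Y' [k kpq]] := surj_ses pqs.
  have [j' [q' [jq' j'E _]]] := kernel_comp_ses ip jq kpq.
  have [f' f'E] := extA _ _ _ _ jq' f.
  have [g gE] := extC _ _ _ _ kpq f'.
  by exists g => x; rewrite -j'E gE f'E.
(* Horseshoe lemma: [PA * PC] covers [B] through a lift of [pC], and the kernel is an extension of
   [KC] by [KA]. *)
move=> [KA [PA [iA [pA [projA sA extA]]]]] [KC [PC [iC [pC [projC sC extC]]]]].
have [l lE] := projC _ _ p pC (ses_surj ip).
pose pB := copair_lin (i \o pA) l.
have pBs : surjective pB.
  move=> y; have [x xE] := ses_surj sC (p y).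
  have [|a aE] := ses_ker ip (y := y - l x).
    by rewrite linearB lE xE subrr.
  have [b bE] := ses_surj sA a.
  by exists (b, x); rewrite copair_linE /= bE aE subrK.
have ppB x : p (pB x) = pC x.2.
  by rewrite copair_linE linearD /= (ses_comp ip) add0r lE.
have [KB [iB sB]] := surj_ses pBs.
have [|u uE] := ses_lift sB (f := pair_lin iA 0).
  by move=> x; rewrite copair_linE /= (ses_comp sA) !linear0 addr0.
have [|v vE] := ses_lift sC (f := snd \o iB).
  by move=> x; rewrite /= -ppB (ses_comp sB) linear0.
exists KB, (PA * PC)%type, iB, pB; split=> //; first exact: projective_pair.
apply: (IHn KA KB KC u v) => //; split.
- move=> x y e; apply: (ses_inj sA); have:= uE x; by rewrite e uE => -[].
- move=> y; split=> [vy|[x <-]]; last by apply: (ses_inj0 sC); rewrite vE /= uE.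
  have y2 : (iB y).2 = 0 by rewrite -[LHS]vE vy linear0.
  have [|x xE] := ses_ker sA (y := (iB y).1).
    apply: (ses_inj0 ip); have:= ses_comp sB y.
    by rewrite copair_linE y2 linear0 addr0.
  exists x; apply: (ses_inj sB); rewrite uE /= xE.
  by rewrite [RHS]surjective_pairing y2.
- move=> y; have [|a aE] := ses_ker ip (y := l (iC y)).
    by rewrite lE (ses_comp sC).
  have [b bE] := ses_surj sA a.
  have [|z zE] := ses_ker sB (y := (- b, iC y)).
    by rewrite copair_linE /= !linearN bE aE addNr.
  by exists z; apply: (ses_inj sC); rewrite vE /= zE.
Qed.

(** The sequence splits as [P] is projective, so [B] is the direct sum of [K] and [P]. *)
Lemma ext0_kernel n K B P (k : {linear K -> B}) (p : {linear B -> P}) :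
  short_exact k p -> projective P -> ext0 n B -> ext0 n K.
Proof.
move=> kp projP; case: n => [|n].
  move=> extB X Y j q jq f.
  have [s [r [ps rk rs kr]]] := ses_projective_split kp projP.
  (* An extension [Y] of [K] by [X] gives the extension [Y * P] of [B] by [X], to which the
     hypothesis on [B] applies. *)
  have [|g gE] := extB X (Y * P)%type
      (pair_lin j 0) (copair_lin (k \o q) s) _ f.
  - split.
    + by move=> x y [/(ses_inj jq)].
    + move=> [y z]; rewrite copair_linE /=.
      split=> [yz|[x [<- <-]]]; last first.
        by rewrite (ses_comp jq) !linear0 addr0.
      have z0 : z = 0.
        by have:= congr1 p yz; rewrite linearD (ses_comp kp) add0r ps linear0.
      have [|x xE] := ses_ker jq (y := y); last by exists x; rewrite xE z0.
      by move: yz; rewrite z0 linear0 addr0 => /(ses_inj0 kp).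
    + move=> b; have [y yE] := ses_surj jq (r b).
      by exists (y, p b); rewrite copair_linE /= yE kr subrK.
  by exists (g \o pair_lin idfun 0) => x; rewrite -gE.
move=> [L [R [i [q [projR iq extL]]]]].
have pqs : surjective (p \o q).
  move=> z; have [y yE] := ses_surj kp z; have [x xE] := ses_surj iq y.
  by exists x; rewrite /= xE.
(* The kernel [R'] of the composite onto [P] is a direct summand of [R], hence projective, and
   covers [K] with the same kernel [L]. *)
have [R' [k' k'pq]] := surj_ses pqs.
have [s [r [_ rk' _ _]]] := ses_projective_split k'pq projP.
have [i' [q' [iq' _ _]]] := kernel_comp_ses kp iq k'pq.
by exists L, R', i', q'; split=> //; exact: projective_retract rk' projR.
Qed.

(* Schanuel: the pullback of two surjections from projectives onto [M] is an
   extension of a projective by either kernel. *)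
Lemma ext0_syzygy n K P M (i : {linear K -> P}) (p : {linear P -> M}) :
  short_exact i p -> projective P -> ext0 n.+1 M -> ext0 n K.
Proof.
move=> ip projP [K' [P' [i' [p' [projP' ip' extK']]]]].
have [Z [q [q' pb]]] := mod_pullback_exists p p'.
have [j' jq'] := mod_pullback_ses_exists (mod_pullback_sym pb) ip'.
have [j jq] := mod_pullback_ses_exists pb ip.
apply: (ext0_kernel jq projP').
by apply: (ext0_ext jq' extK'); exact: ext0_projective.
Qed.

Lemma ext0_iso n A B (f : {linear A -> B}) :
  bijective f -> ext0 n B -> ext0 n A.
Proof.
move=> [g fK gK] extB.
have s : short_exact (0 : {linear 'rV[S]_0 -> A}) f.
  split=> [x y _|y|y]; first by apply/rowP; case.
    split=> [fy|[x <-]]; last exact: linear0.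
    by exists 0; apply: (can_inj fK); rewrite fy !linear0.
  by exists (g y).
apply: (ext0_ext s) extB; apply: ext0_projective.
by case: (fg_projective_row S 0).
Qed.

(** Dropping degree 0 of [R] resolves its first syzygy [K]. The definition is transparent so that
    its differentials compute to those of [R]. *)
Definition res_tail M (R : proj_resolution M) K
    (i : {linear K -> res_mod R 0}) (ip : short_exact i (res_aug R))
    (a : {linear res_mod R 1 -> K}) (aE : forall x, i (a x) = res_diff R 0 x) :
  proj_resolution K.
Proof.
refine (@ProjResolution _ _ (fun k => res_mod R k.+1)
  (fun k => res_diff R k.+1) a _ _ _ _).
- by move=> k; exact: res_projective.
- move=> y; have [x xE] := (res_exact0 (i y)).1 (ses_comp ip y).
  by exists x; apply: (ses_inj ip); rewrite aE.
- move=> y; rewrite -(@res_exactS _ _ R 0 y) -aE.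
  by split=> [->|/(ses_inj0 ip)//]; rewrite linear0.
- by move=> k; exact: res_exactS.
Defined.

(** Cocycles of degree 1 are the maps on the first syzygy [K], and coboundaries are those that
    extend to [res_mod R 0]. In higher degrees both sides shift to [K], resolved by [res_tail]. *)
Lemma ext0_resolution n M (R : proj_resolution M) :
  res_cohomology_vanishes N R n.+1 <-> ext0 n M.
Proof.
elim: n M R => [|n IHn] M R.
all: have [K [i ip]] := surj_ses (@res_aug_surj _ _ R).
all: have [|a aE] := ses_lift ip (f := res_diff R 0);
  first by move=> x; apply/res_exact0; exists x.
all: have ip' := ip; pose T := res_tail ip aE.
  split=> [exN|extM f].
    apply: (ext0_presentation _ ip) => [|f]; first exact: res_projective.
    have [|h hE] := (exN (f \o a)).1.
      apply: linear_ext => x /=; rewrite (_ : a _ = 0) ?linear0 //.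
      by apply/(@res_exact0 _ _ T); exists x.
    exists h => x; have [y <-] := @res_aug_surj _ _ T x.
    by rewrite /= aE; have:= congr1 (fun u : {linear _ -> _} => u y) hE.
  split=> [fd|[h <-]]; last first.
    apply: linear_ext => x /=; rewrite (_ : res_diff R 0 _ = 0) ?linear0 //.
    by apply/res_exactS; exists x.
  have [|h hE] := factor_surj (@res_aug_surj _ _ T) (f := f).
    move=> x /(@res_exact0 _ _ T)[y <-].
    by have:= congr1 (fun u : {linear _ -> _} => u y) fd.
  have [g gE] := extM _ _ _ _ ip h.
  by exists g; apply: linear_ext => x; rewrite /= -aE gE hE.
have /= TE := IHn K T; split=> [/TE extK|extM].
  by exists K, (res_mod R 0), i, (res_aug R); split=> //; exact: res_projective.
by apply/TE; exact: (ext0_syzygy ip (@res_projective _ _ R 0) extM).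
Qed.

End ExtVanishing.

(** * Gorenstein projective modules *)

Section FreeResolutions.
Variable S : comNzRingType.
Hypothesis noethS : noetherian S.

(** The kernel is recorded with its finite generation so that covers can be iterated. *)
Record free_cover_data (M : lmodType S) := FreeCoverData {
  fc_rank : nat;
  fc_ker : lmodType S;
  fc_inc : {linear fc_ker -> 'rV[S]_fc_rank};
  fc_map : {linear 'rV[S]_fc_rank -> M};
  fc_ses : short_exact fc_inc fc_map;
  fc_fin_gen : fin_gen fc_ker
}.

Lemma free_cover_data_exists (M : lmodType S) :
  fin_gen M -> exists _ : free_cover_data M, True.
Proof.
move=> /free_cover[k [p ps]]; have [K [i ip]] := surj_ses ps.
have fgK := fin_gen_sub_projective noethS (fg_projective_row S k) (ses_inj ip).
by exists (FreeCoverData ip fgK).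
Qed.

Lemma free_resolution_exists (M : lmodType S) :
  fin_gen M -> inhabited (proj_resolution M).
Proof.
move=> fgM; pose cov M h := projT1 (cid (@free_cover_data_exists M h)).
(* [syz n] is the n-th syzygy bundled with a proof of finite generation, and [c n] below is its
   cover; the differentials splice consecutive covers. *)
pose syz := fix syz n : {M : lmodType S & fin_gen M} :=
  if n is m.+1 then let c := cov _ (projT2 (syz m)) in
    existT _ (fc_ker c) (fc_fin_gen c)
  else existT _ M fgM.
pose c n := cov _ (projT2 (syz n)).
constructor; apply: (@ProjResolution S M (fun n => 'rV[S]_(fc_rank (c n)))
  (fun n => fc_inc (c n) \o fc_map (c n.+1)) (fc_map (c 0%N))).
- by move=> n; case: (fg_projective_row S (fc_rank (c n))).
- exact: ses_surj (fc_ses (c 0%N)).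
- move=> y; split=> [/(ses_ker (fc_ses (c 0%N)))[x <-]|[x <-]].
    by have [z <-] := ses_surj (fc_ses (c 1%N)) x; exists z.
  exact: (ses_comp (fc_ses (c 0%N))).
- move=> n y; split=> [/(ses_inj0 (fc_ses (c n)))|[x <-]].
    move=> /(ses_ker (fc_ses (c n.+1)))[x <-].
    by have [z <-] := ses_surj (fc_ses (c n.+2)) x; exists z.
  by rewrite /= (ses_comp (fc_ses (c n.+1))) linear0.
Qed.

(** One direction holds for any given resolution; the other needs one to exist, which is where
    finite generation enters. *)
Lemma Ext_vanishesP n (M N : lmodType S) :
  fin_gen M -> Ext_vanishes n.+1 M N <-> ext0 N n M.
Proof.
move=> /free_resolution_exists[R]; split=> [[R' /ext0_resolution]//|extM].
by exists R; apply/ext0_resolution.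
Qed.

End FreeResolutions.

Lemma inj_surj_bijective (A B : Type) (f : A -> B) :
  injective f -> surjective f -> bijective f.
Proof.
by move=> inj_f /boolp.choice[g gE]; exists g => // x; apply: inj_f; rewrite gE.
Qed.

Lemma bijective_surj (A B : Type) (f : A -> B) : bijective f -> surjective f.
Proof. by case=> g _ gK y; exists (g y). Qed.

Lemma linear_bijective (S : comNzRingType) (U V : lmodType S)
    (f : {linear U -> V}) :
  bijective f -> exists2 g : {linear V -> U}, cancel f g & cancel g f.
Proof.
case=> g fK gK; have g_lin : linear g.
  by move=> a x y; apply: (can_inj fK); rewrite linearP !gK.
by exists (mklin g_lin).
Qed.

(** * Two cases of the five lemma *)

Section FiveLemma.
Variables (S : comNzRingType) (A B C A' B' C' : lmodType S).
Variables (i : {linear A -> B}) (p : {linear B -> C}).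
Variables (i' : {linear A' -> B'}) (p' : {linear B' -> C'}).
Variables (a : {linear A -> A'}) (b : {linear B -> B'}) (c : {linear C -> C'}).
Hypotheses (ip : short_exact i p) (ip' : short_exact i' p').
Hypothesis bi : forall x, b (i x) = i' (a x).
Hypothesis cp : forall x, c (p x) = p' (b x).

Lemma five_middle : bijective a -> bijective c -> bijective b.
Proof.
move=> ba bc; have [ia ic] := (bij_inj ba, bij_inj bc).
apply: inj_surj_bijective => [|y].
  apply: linear_inj0 => x bx.
  have [|z zE] := ses_ker ip (y := x).
    by apply: ic; rewrite cp bx !linear0.
  suff z0 : z = 0 by rewrite -zE z0 linear0.
  by apply: ia; apply: (ses_inj ip'); rewrite -bi zE bx !linear0.
have [z zE] := bijective_surj bc (p' y); have [x xE] := ses_surj ip z.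
have [|u uE] := ses_ker ip' (y := y - b x).
  by rewrite linearB -cp xE zE subrr.
have [v vE] := bijective_surj ba u.
by exists (i v + x); rewrite linearD bi vE uE subrK.
Qed.

Lemma five_left : bijective b -> bijective c -> bijective a.
Proof.
move=> bb bc; have [ib ic] := (bij_inj bb, bij_inj bc).
apply: inj_surj_bijective => [x y e|y].
  by apply: (ses_inj ip); apply: ib; rewrite !bi e.
have [x xE] := bijective_surj bb (i' y).
have [|z zE] := ses_ker ip (y := x).
  by apply: ic; rewrite cp xE (ses_comp ip') linear0.
by exists z; apply: (ses_inj ip'); rewrite -bi zE.
Qed.

End FiveLemma.

(** * Closure properties of Gorenstein projective modules *)

Section GorensteinProjectives.
Variable S : comNzRingType.
Implicit Types A B C G K M P Q : lmodType S.
Local Notation dual M := ({linear M -> S^o} : lmodType S).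

Fact dual_map_linear A B (f : {linear A -> B}) :
  linear (precomp (N := S^o) f : dual B -> dual A).
Proof. by move=> a x y; apply: linear_ext. Qed.

Definition dual_map A B (f : {linear A -> B}) : {linear dual B -> dual A} :=
  mklin (dual_map_linear f).

Lemma dual_mapE A B (f : {linear A -> B}) (u : dual B) x :
  dual_map f u x = u (f x).
Proof. by []. Qed.

Lemma biduality_map A B (f : {linear A -> B}) x :
  biduality (f x) = dual_map (dual_map f) (biduality x).
Proof. exact: linear_ext. Qed.

(** Dualizing is left exact; vanishing of Ext^1 from [C] to [S] supplies surjectivity of restriction
    along [i]. *)
Lemma dual_ses A B C (i : {linear A -> B}) (p : {linear B -> C}) :
  short_exact i p -> ext0 S^o 0 C -> short_exact (dual_map p) (dual_map i).
Proof.
move=> ip extC; split=> [u v uv|u|u].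
- apply: linear_ext; apply: (surj_cancel (ses_surj ip)) => x.
  by rewrite -!dual_mapE uv.
- split=> [iu|[v <-]].
    have [|v vE] := ses_desc ip (f := u); last by exists v; apply: linear_ext.
    by move=> x; rewrite -dual_mapE iu.
  by apply: linear_ext => x; rewrite !dual_mapE (ses_comp ip) linear0.
- by have [v vE] := extC _ _ _ _ ip u; exists v; apply: linear_ext.
Qed.

Hypothesis noethS : noetherian S.

Lemma gorenstein_projectiveP M : gorenstein_projective M <->
  [/\ fin_gen M, forall n, ext0 S^o n M, forall n, ext0 S^o n (dual M)
    & bijective (biduality (M := M))].
Proof.
split=> -[fgM e e' bM]; split=> //.
- by move=> n; apply/Ext_vanishesP => //; exact: e.
- by move=> n; apply/Ext_vanishesP => //; [exact: fin_gen_dual|exact: e'].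
- by case=> // n _; apply/Ext_vanishesP.
- by case=> // n _; apply/Ext_vanishesP => //; exact: fin_gen_dual.
Qed.

(** The first dual is exact by the condition on [C], the second by the condition on the dual of [A];
    biduality is then a map of short exact sequences, bijective at both ends. *)
Lemma gp_ext A B C (i : {linear A -> B}) (p : {linear B -> C}) :
  short_exact i p -> gorenstein_projective A -> gorenstein_projective C ->
  gorenstein_projective B.
Proof.
move=> ip /gorenstein_projectiveP[fA eA eA' bA].
move=> /gorenstein_projectiveP[fC eC eC' bC].
have ip' := dual_ses ip (eC 0%N); have ip'' := dual_ses ip' (eA' 0%N).
apply/gorenstein_projectiveP; split.
- exact: fin_gen_ses ip fA fC.
- by move=> n; exact: ext0_ext ip (eA n) (eC n).
- by move=> n; exact: ext0_ext ip' (eC' n) (eA' n).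
- by apply: (five_middle ip ip'' _ _ bA bC) => x; rewrite /= biduality_map.
Qed.

Lemma gp_syzygy K P G (i : {linear K -> P}) (p : {linear P -> G}) :
  short_exact i p -> fg_projective P -> gorenstein_projective G ->
  gorenstein_projective K.
Proof.
move=> ip fgP /gorenstein_projectiveP[fG eG eG' bG].
have [_ projP] := fgP; have [_ projP'] := fg_projective_dual fgP.
have [_ _ _ bP] := fg_projective_gorenstein fgP.
have ip' := dual_ses ip (eG 0%N).
(* The dual of [K] is presented by the duals of [G] and [P]. In degree 0, a functional on the dual
   of [G] is evaluation at some [p y], and evaluation at [y] extends it; higher degrees shift to the
   dual of [G]. *)
have eK' n : ext0 S^o n (dual K).
  case: n => [|n].
    2: by exists (dual G), (dual P), (dual_map p), (dual_map i).
  apply: (ext0_presentation projP' ip') => f.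
  have [x <-] := bijective_surj bG f; have [y <-] := ses_surj ip x.
  by exists (biduality y).
apply/gorenstein_projectiveP; split=> //.
- exact: (fin_gen_sub_projective noethS fgP (ses_inj ip)).
- by move=> n; exact: (ext0_syzygy ip projP (eG n.+1)).
- have ip'' := dual_ses ip' (eK' 0%N).
  by apply: (five_left ip ip'' _ _ bP bG) => x; rewrite /= biduality_map.
Qed.

(** Biduality identifies [M] with its double dual and so transfers the Ext conditions. Restricting
    functionals along biduality of [M] inverts biduality of the dual. *)
Lemma gp_dual M : gorenstein_projective M -> gorenstein_projective (dual M).
Proof.
move=> /gorenstein_projectiveP[fM eM eM' bM].
apply/gorenstein_projectiveP; split=> //; first exact: fin_gen_dual.
  move=> n; have [g bK gK] := linear_bijective bM.
  by apply: (ext0_iso (f := g)) (eM n); exists (biduality (M := M)).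
apply: inj_surj_bijective => [u v uv|f].
  apply: linear_ext => x.
  by have := congr1 (fun h : dual (dual (dual M)) => h (biduality x)) uv.
have u_lin : linear (fun x => f (biduality x) : S^o).
  by move=> a x y; rewrite !linearP.
exists (mklin u_lin); apply: linear_ext => h.
by have [x <-] := bijective_surj bM h.
Qed.

Lemma gp_embed G : gorenstein_projective G ->
  exists Q C (m : {linear G -> Q}) (c : {linear Q -> C}),
    [/\ fg_projective Q, gorenstein_projective C & short_exact m c].
Proof.
move=> gpG; have gpG' := gp_dual gpG.
case: (gpG') => /free_cover[k [p ps]] _ _ _.
have [K [i ip]] := surj_ses ps; have fgP := fg_projective_row S k.
have gpK := gp_syzygy ip fgP gpG'.
have [_ _ _ bG] := gpG.
have [_ /(_ 0%N) eG' _ _] := (gorenstein_projectiveP _).1 gpG'.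
have ip' := dual_ses ip eG'.
(* The embedding is biduality of [G] followed by the dual of the cover [p]; its cokernel is the dual
   of the syzygy [K]. *)
exists (dual ('rV[S]_k : lmodType S)), (dual K).
exists (dual_map p \o biduality (M := G)), (dual_map i).
split; [exact: fg_projective_dual|exact: gp_dual|split=> [|y|]].
- exact: inj_comp (ses_inj ip') (bij_inj bG).
- split=> [/(ses_ker ip')[x <-]|[x <-]]; last exact: (ses_comp ip').
  by have [z <-] := bijective_surj bG x; exists z.
- exact: ses_surj ip'.
Qed.

(** This is Ext^1([C], [P]) = 0: a dual basis of [P] reduces it to extending the coordinate
    functionals of [f], where the defining condition on [C] applies. *)
Lemma gp_extend A B C P (i : {linear A -> B}) (p : {linear B -> C})
    (f : {linear A -> P}) :
  short_exact i p -> gorenstein_projective C -> fg_projective P ->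
  exists g : {linear B -> P}, forall x, g (i x) = f x.
Proof.
move=> ip /gorenstein_projectiveP[_ /(_ 0%N) eC _ _] /dual_basis[k [e [b bE]]].
have /boolp.choice[h hE] j := eC _ _ _ _ ip (b j \o f).
have g_lin : linear (fun x => \sum_j (h j x : S) *: e j).
  move=> c x y; rewrite scaler_sumr -big_split; apply: eq_bigr => j _ /=.
  by rewrite linearP scalerDl scalerA.
exists (mklin g_lin) => x; rewrite [RHS]bE.
by apply: eq_bigr => j _; rewrite hE.
Qed.

Lemma gp_pair A B : gorenstein_projective A -> gorenstein_projective B ->
  gorenstein_projective (A * B)%type.
Proof. exact: gp_ext (pair_ses A B). Qed.

End GorensteinProjectives.

(** * Preadditive categories *)

Section Preadditive.
Variable C : preadditive.
Implicit Types A B E X Y Z : C.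

Lemma comp0m A B X (f : hom A B) : (0 : hom B X) ∘ f = 0.
Proof. by apply: (addrI (0 ∘ f)); rewrite -compDl !addr0. Qed.

Lemma compm0 A B X (h : hom B X) : h ∘ (0 : hom A B) = 0.
Proof. by apply: (addrI (h ∘ 0)); rewrite -compDr !addr0. Qed.

Lemma compBl A B X (g h : hom B X) (f : hom A B) : (g - h) ∘ f = g ∘ f - h ∘ f.
Proof. by apply/eqP; rewrite eq_sym subr_eq -compDl subrK. Qed.

Lemma compBr A B X (h : hom B X) (f g : hom A B) : h ∘ (f - g) = h ∘ f - h ∘ g.
Proof. by apply/eqP; rewrite eq_sym subr_eq -compDr subrK. Qed.

Lemma comp_suml (I : finType) A B X (g : I -> hom B X) (f : hom A B) :
  (\sum_k g k) ∘ f = \sum_k (g k ∘ f).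
Proof.
apply: (big_morph (fun g => g ∘ f)); last exact: comp0m.
by move=> x y; exact: compDl.
Qed.

Lemma comp_sumr (I : finType) A B X (h : hom B X) (f : I -> hom A B) :
  h ∘ (\sum_k f k) = \sum_k (h ∘ f k).
Proof.
apply: (big_morph (fun f => h ∘ f)); last exact: compm0.
by move=> x y; exact: compDr.
Qed.

(** The retraction [r] is the factorization of [idm E - s ∘ p] through the kernel; its identities
    are checked after composing with the monomorphism [i]. *)
Lemma split_epi_biproduct A E X (i : hom A E) (p : hom E X) (s : hom X E) :
  is_kernel i p -> p ∘ s = idm X -> is_biproduct X A E.
Proof.
move=> [pi0 ker] ps.
have [|r [ir _]] := ker _ (idm E - s ∘ p).
  by rewrite compBr compm1 compA ps comp1m subrr.
have imono Y (u v : hom Y A) : i ∘ u = i ∘ v -> u = v.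
  move=> uv; have [|g [_ gU]] := ker _ (i ∘ u).
    by rewrite compA pi0 comp0m.
  by rewrite -(gU u) // -(gU v).
exists s, i, p, r; split=> //; last by rewrite ir addrC subrK.
  apply: imono; rewrite compA ir compBl comp1m -compA pi0 compm0 subr0.
  by rewrite compm1.
apply: imono; rewrite compA ir compBl comp1m -compA ps compm1 subrr.
by rewrite compm0.
Qed.

Lemma split_mono_biproduct A E X (i : hom A E) (p : hom E X) (r : hom E A) :
  is_cokernel i p -> r ∘ i = idm A -> is_biproduct A X E.
Proof.
move=> [pi0 coker] ri.
have [|s [sp _]] := coker _ (idm E - i ∘ r).
  by rewrite compBl comp1m -compA ri compm1 subrr.
have pepi Y (u v : hom X Y) : u ∘ p = v ∘ p -> u = v.
  move=> uv; have [|g [_ gU]] := coker _ (u ∘ p).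
    by rewrite -compA pi0 compm0.
  by rewrite -(gU u) // -(gU v).
exists i, s, r, p; split=> //; last by rewrite sp addrC subrK.
  apply: pepi; rewrite -compA sp compBr compm1 compA pi0 comp0m subr0.
  by rewrite comp1m.
apply: pepi; rewrite -compA sp compBr compm1 compA ri comp1m subrr.
by rewrite comp0m.
Qed.

Variable xi : forall A B X, hom A B -> hom B X -> Prop.

(** Starting from a decomposition of the identity treats finite direct sums, biproducts and, with a
    one-element index, direct summands in one proof. *)
Lemma projective_object_sum (I : finType) (X : I -> C) Z
    (inj : forall k, hom (X k) Z) (prj : forall k, hom Z (X k)) :
  \sum_k inj k ∘ prj k = idm Z ->
  (forall k, projective_object xi (X k)) -> projective_object xi Z.
Proof.
move=> idZ projX A B p f dp.
pose g k := projT1 (cid (projX k _ _ p (f ∘ inj k) dp)).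
exists (\sum_k g k ∘ prj k); rewrite comp_sumr -[RHS]compm1 -idZ comp_sumr.
by apply: eq_bigr => k _; rewrite !compA (projT2 (cid (projX k _ _ p _ dp))).
Qed.

Lemma injective_object_sum (I : finType) (X : I -> C) Z
    (inj : forall k, hom (X k) Z) (prj : forall k, hom Z (X k)) :
  \sum_k inj k ∘ prj k = idm Z ->
  (forall k, injective_object xi (X k)) -> injective_object xi Z.
Proof.
move=> idZ injX A B i f di.
pose g k := projT1 (cid (injX k _ _ i (prj k ∘ f) di)).
exists (\sum_k inj k ∘ g k); rewrite comp_suml -[RHS]comp1m -idZ comp_suml.
by apply: eq_bigr => k _; rewrite -!compA (projT2 (cid (injX k _ _ i _ di))).
Qed.

Lemma biproduct_idm_sum X Y Z : is_biproduct X Y Z ->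
  exists (inj : forall b : bool, hom (if b then X else Y) Z)
    (prj : forall b : bool, hom Z (if b then X else Y)),
  \sum_b inj b ∘ prj b = idm Z.
Proof.
move=> [i1 [i2 [p1 [p2 [_ _ _ _ idZ]]]]].
exists (fun b => if b return hom (if b then X else Y) Z then i1 else i2).
exists (fun b => if b return hom Z (if b then X else Y) then p1 else p2).
by rewrite big_bool.
Qed.

Lemma projective_object_biproduct X Y Z : is_biproduct X Y Z ->
  projective_object xi X -> projective_object xi Y -> projective_object xi Z.
Proof.
move=> /biproduct_idm_sum[inj [prj idZ]] projX projY.
by apply: (projective_object_sum idZ); case.
Qed.

Lemma injective_object_biproduct X Y Z : is_biproduct X Y Z ->
  injective_object xi X -> injective_object xi Y -> injective_object xi Z.
Proof.
move=> /biproduct_idm_sum[inj [prj idZ]] injX injY.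
by apply: (injective_object_sum idZ); case.
Qed.

Lemma projective_object_summand X Z : is_direct_summand X Z ->
  projective_object xi Z -> projective_object xi X.
Proof.
move=> [Y [i1 [i2 [p1 [p2 [pi _ _ _ _]]]]]] projZ.
apply: (@projective_object_sum unit (fun=> Z) X (fun=> p1) (fun=> i1)) => //.
by rewrite (big_pred1 tt) //; case.
Qed.

Lemma injective_object_summand X Z : is_direct_summand X Z ->
  injective_object xi Z -> injective_object xi X.
Proof.
move=> [Y [i1 [i2 [p1 [p2 [pi _ _ _ _]]]]]] injZ.
apply: (@injective_object_sum unit (fun=> Z) X (fun=> p1) (fun=> i1)) => //.
by rewrite (big_pred1 tt) //; case.
Qed.

Lemma direct_sum_single X : is_direct_sum (fun _ : 'I_1 => X) X.
Proof.
exists (fun=> idm X), (fun=> idm X); split=> [k|k l|].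
- exact: comp1m.
- by rewrite !ord1.
- by rewrite big_ord1 comp1m.
Qed.

End Preadditive.

(** * The exact category of matrix factorizations *)

Section MatrixFactorizationCategory.
Variables (S : comNzRingType) (w : S).
Implicit Types (A B X Y E : MF w) (C K P Q : lmodType S).
Local Notation xi := (mf_ses (w := w)).

Lemma mf_ext X Y (f g : hom X Y) :
  (forall x, mf_phi1 f x = mf_phi1 g x) ->
  (forall x, mf_phi0 f x = mf_phi0 g x) -> f = g.
Proof. by move=> e1 e0; apply: mf_hom_ext; exact: linear_ext. Qed.

Lemma mf_phi1_eq X Y (f g : hom X Y) x : f = g -> mf_phi1 f x = mf_phi1 g x.
Proof. by move->. Qed.
Lemma mf_phi0_eq X Y (f g : hom X Y) x : f = g -> mf_phi0 f x = mf_phi0 g x.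
Proof. by move->. Qed.

(** Factorizations exist componentwise; that they commute with the structure maps is checked after
    an injection, respectively before a surjection. *)
Lemma mf_ses_kernel_cokernel A B X (i : hom A B) (p : hom B X) :
  xi i p -> is_kernel i p /\ is_cokernel i p.
Proof.
move=> [s1 s0].
have pi : p ∘ i = 0.
  by apply: mf_ext => x; [exact: (ses_comp s1)|exact: (ses_comp s0)].
split; split=> // Y f pf.
  have [|g1 g1E] := ses_lift s1 (f := mf_phi1 f).
    by move=> x; exact: mf_phi1_eq pf.
  have [|g0 g0E] := ses_lift s0 (f := mf_phi0 f).
    by move=> x; exact: mf_phi0_eq pf.
  have c1 x : mf_g1 A (g1 x) = g0 (mf_g1 Y x).
    by apply: (ses_inj s0); rewrite g0E -mf_comm1 g1E mf_comm1.
  have c0 x : mf_g0 A (g0 x) = g1 (mf_g0 Y x).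
    by apply: (ses_inj s1); rewrite g1E -mf_comm0 g0E mf_comm0.
  exists (MFHom c1 c0); split; first exact: mf_ext.
  move=> h ih; apply: mf_ext => x.
    by apply: (ses_inj s1); rewrite g1E; apply/esym/(mf_phi1_eq x ih).
  by apply: (ses_inj s0); rewrite g0E; apply/esym/(mf_phi0_eq x ih).
have [|g1 g1E] := ses_desc s1 (f := mf_phi1 f).
  by move=> x; exact: mf_phi1_eq pf.
have [|g0 g0E] := ses_desc s0 (f := mf_phi0 f).
  by move=> x; exact: mf_phi0_eq pf.
have c1 : forall x, mf_g1 Y (g1 x) = g0 (mf_g1 X x).
  apply: (surj_cancel (ses_surj s1) (f := mf_g1 Y \o g1)
    (g := g0 \o mf_g1 X)) => x.
  by rewrite /= mf_comm1 g0E g1E mf_comm1.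
have c0 : forall x, mf_g0 Y (g0 x) = g1 (mf_g0 X x).
  apply: (surj_cancel (ses_surj s0) (f := mf_g0 Y \o g0)
    (g := g1 \o mf_g0 X)) => x.
  by rewrite /= mf_comm0 g0E g1E mf_comm0.
exists (MFHom c1 c0); split; first exact: mf_ext.
move=> h hp; apply: mf_ext.
  apply: (surj_cancel (ses_surj s1)) => x; rewrite /= g1E.
  by apply/esym/(mf_phi1_eq x hp).
apply: (surj_cancel (ses_surj s0)) => x; rewrite /= g0E.
by apply/esym/(mf_phi0_eq x hp).
Qed.

(** The structure maps of [B] restrict to the componentwise kernels. Quantifying over all kernels
    frees the callers from the particular ones chosen here. *)
Lemma mf_deflation B X (p : hom B X) :
  surjective (mf_phi1 p) -> surjective (mf_phi0 p) ->
  (forall K (k : {linear K -> mf1 B}), short_exact k (mf_phi1 p) ->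
    gorenstein_projective K) ->
  (forall K (k : {linear K -> mf0 B}), short_exact k (mf_phi0 p) ->
    gorenstein_projective K) ->
  deflation xi p.
Proof.
move=> /surj_ses[K1 [k1 s1]] /surj_ses[K0 [k0 s0]].
move=> /(_ _ _ s1) gp1 /(_ _ _ s0) gp0.
have [|g1 g1E] := ses_lift s0 (f := mf_g1 B \o k1).
  by move=> x; rewrite /= -mf_comm1 (ses_comp s1) linear0.
have [|g0 g0E] := ses_lift s1 (f := mf_g0 B \o k0).
  by move=> x; rewrite /= -mf_comm0 (ses_comp s0) linear0.
have g1g0 x : g1 (g0 x) = w *: x.
  by apply: (ses_inj s0); rewrite g1E /= g0E /= mf_g1g0 linearZ.
have g0g1 x : g0 (g1 x) = w *: x.
  by apply: (ses_inj s1); rewrite g0E /= g1E /= mf_g0g1 linearZ.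
exists (MFObject gp1 gp0 g1g0 g0g1).
by exists (@MFHom _ _ (MFObject gp1 gp0 g1g0 g0g1) B k1 k0
  (fun x => esym (g1E x)) (fun x => esym (g0E x))).
Qed.

(** Dual to [mf_deflation]: the structure maps of [B] descend to the componentwise cokernels. *)
Lemma mf_inflation A B (i : hom A B) :
  injective (mf_phi1 i) -> injective (mf_phi0 i) ->
  (forall C (c : {linear mf1 B -> C}), short_exact (mf_phi1 i) c ->
    gorenstein_projective C) ->
  (forall C (c : {linear mf0 B -> C}), short_exact (mf_phi0 i) c ->
    gorenstein_projective C) ->
  inflation xi i.
Proof.
move=> /inj_ses[C1 [c1 s1]] /inj_ses[C0 [c0 s0]].
move=> /(_ _ _ s1) gp1 /(_ _ _ s0) gp0.
have [|g1 g1E] := ses_desc s1 (f := c0 \o mf_g1 B).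
  by move=> x; rewrite /= mf_comm1 (ses_comp s0).
have [|g0 g0E] := ses_desc s0 (f := c1 \o mf_g0 B).
  by move=> x; rewrite /= mf_comm0 (ses_comp s1).
have g1g0 : forall x, g1 (g0 x) = w *: x.
  apply: (surj_cancel (ses_surj s0) (f := g1 \o g0) (g := *:%R w)) => x.
  by rewrite /= g0E /= g1E /= mf_g1g0 linearZ.
have g0g1 : forall x, g0 (g1 x) = w *: x.
  apply: (surj_cancel (ses_surj s1) (f := g0 \o g1) (g := *:%R w)) => x.
  by rewrite /= g1E /= g0E /= mf_g0g1 linearZ.
exists (MFObject gp1 gp0 g1g0 g0g1).
by exists (@MFHom _ _ B (MFObject gp1 gp0 g1g0 g0g1) c1 c0 g1E g0E).
Qed.

Hypothesis noethS : noetherian S.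

Fact mf_pair_g1g0 X Y (x : (mf0 X * mf0 Y)%type) :
  pair_lin (mf_g1 X \o fst) (mf_g1 Y \o snd)
    (pair_lin (mf_g0 X \o fst) (mf_g0 Y \o snd) x) = w *: x.
Proof. by rewrite /= !mf_g1g0 [x in RHS]surjective_pairing. Qed.

Fact mf_pair_g0g1 X Y (x : (mf1 X * mf1 Y)%type) :
  pair_lin (mf_g0 X \o fst) (mf_g0 Y \o snd)
    (pair_lin (mf_g1 X \o fst) (mf_g1 Y \o snd) x) = w *: x.
Proof. by rewrite /= !mf_g0g1 [x in RHS]surjective_pairing. Qed.

Definition mf_pair X Y : MF w :=
  MFObject (gp_pair noethS (mf_gproj1 X) (mf_gproj1 Y))
    (gp_pair noethS (mf_gproj0 X) (mf_gproj0 Y))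
    (@mf_pair_g1g0 X Y) (@mf_pair_g0g1 X Y).

Lemma mf_pair_biproduct X Y : is_biproduct X Y (mf_pair X Y).
Proof.
have [c1 c0] :
    (forall x : mf1 X, mf_g1 (mf_pair X Y) (x, 0) = (mf_g1 X x, 0)) /\
    (forall x : mf0 X, mf_g0 (mf_pair X Y) (x, 0) = (mf_g0 X x, 0)).
  by split=> x /=; rewrite linear0.
have [d1 d0] :
    (forall x : mf1 Y, mf_g1 (mf_pair X Y) (0, x) = (0, mf_g1 Y x)) /\
    (forall x : mf0 Y, mf_g0 (mf_pair X Y) (0, x) = (0, mf_g0 Y x)).
  by split=> x /=; rewrite linear0.
exists (@MFHom _ _ X (mf_pair X Y) (pair_lin idfun 0) (pair_lin idfun 0) c1 c0).
exists (@MFHom _ _ Y (mf_pair X Y) (pair_lin 0 idfun) (pair_lin 0 idfun) d1 d0).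
exists (@MFHom _ _ (mf_pair X Y) X fst fst (fun=> erefl) (fun=> erefl)).
exists (@MFHom _ _ (mf_pair X Y) Y snd snd (fun=> erefl) (fun=> erefl)).
split; apply: mf_ext => // -[x y].
  by congr (_, _); rewrite /= ?addr0 ?add0r.
by congr (_, _); rewrite /= ?addr0 ?add0r.
Qed.

(** The zero module is taken as the free module of rank 0, so that Gorenstein projectivity comes
    with [mf_w_id]. *)
Definition mf_zero_object : MF w := mf_w_id w (fg_projective_row S 0).

Lemma mf_zero_object_zero : is_zero_object mf_zero_object.
Proof.
have Z0 (x : 'rV[S]_0) : x = 0 by apply/rowP; case.
by move=> A; split=> f; apply: mf_ext => x; rewrite ?(Z0 x) ?linear0.
Qed.

End MatrixFactorizationCategory.

Lemma ses_transport (S : comNzRingType) (A B C A' B' C' : lmodType S)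
    (i : {linear A -> B}) (p : {linear B -> C})
    (i' : {linear A' -> B'}) (p' : {linear B' -> C'})
    (a : {linear A -> A'}) (b : {linear B -> B'}) (c : {linear C -> C'}) :
  bijective a -> bijective b -> bijective c ->
  (forall x, b (i x) = i' (a x)) -> (forall x, c (p x) = p' (b x)) ->
  short_exact i p -> short_exact i' p'.
Proof.
move=> ba bb bc bi cp ip; split=> [|y|z].
- apply: linear_inj0 => x; have [u <-] := bijective_surj ba x.
  rewrite -bi -(linear0 b) => /(bij_inj bb)/(ses_inj0 ip)->.
  exact: linear0.
- have [v <-] := bijective_surj bb y; rewrite -cp; split=> [|[x]].
    rewrite -(linear0 c) => /(bij_inj bc)/(ses_ker ip)[u <-].
    by exists (a u); rewrite bi.
  have [u <-] := bijective_surj ba x; rewrite -bi => /(bij_inj bb)<-.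
  by rewrite (ses_comp ip) linear0.
- have [t <-] := bijective_surj bc z; have [v <-] := ses_surj ip t.
  by exists (b v); rewrite cp.
Qed.

(** * Verification of the axioms of an exact category *)

Section MatrixFactorizationExact.
Variables (S : comNzRingType) (w : S).
Implicit Types (A B X Y E : MF w) (C K P Q : lmodType S).
Local Notation xi := (mf_ses (w := w)).

Lemma mf_iso_bijective X Y (f : hom X Y) :
  is_iso f -> bijective (mf_phi1 f) /\ bijective (mf_phi0 f).
Proof.
move=> [g [gf fg]]; split.
- exists (mf_phi1 g) => x; first exact: (mf_phi1_eq x gf).
  exact: (mf_phi1_eq x fg).
- exists (mf_phi0 g) => x; first exact: (mf_phi0_eq x gf).
  exact: (mf_phi0_eq x fg).
Qed.

Lemma mf_ses_iso_closed : iso_closed xi.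
Proof.
move=> A B X A' B' X' i p i' p' a b x.
move=> /mf_iso_bijective[a1 a0] /mf_iso_bijective[b1 b0].
move=> /mf_iso_bijective[x1 x0] bi xp [s1 s0]; split.
- apply: ses_transport a1 b1 x1 _ _ s1 => y.
    exact: (mf_phi1_eq y bi).
  exact: (mf_phi1_eq y xp).
- apply: ses_transport a0 b0 x0 _ _ s0 => y.
    exact: (mf_phi0_eq y bi).
  exact: (mf_phi0_eq y xp).
Qed.

Lemma mf_idm_inflation A : inflation xi (idm A).
Proof.
exists (mf_zero_object w), 0; split; split=> //.
1,3: by move=> y; split=> // _; exists y.
all: by move=> y; exists 0; apply/rowP; case.
Qed.

Lemma mf_idm_deflation A : deflation xi (idm A).
Proof.
exists (mf_zero_object w), 0; split; split.
1,4: by move=> x y _; apply/rowP; case.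
1,3: by move=> y; split=> [/= ->|[x <-] //]; exists 0.
all: by move=> y; exists y.
Qed.

Hypothesis noethS : noetherian S.

Lemma mf_additive : additive_category (MF w).
Proof.
split; first by exists (mf_zero_object w); exact: mf_zero_object_zero.
by move=> X Y; exists (mf_pair noethS X Y); exact: mf_pair_biproduct.
Qed.

(** In each component the cokernel of the composite is an extension of the cokernel of [j] by that
    of [i]. *)
Lemma mf_comp_inflation A B X (i : hom A B) (j : hom B X) :
  inflation xi i -> inflation xi j -> inflation xi (j ∘ i).
Proof.
move=> [C [p [s1 s0]]] [D [q [t1 t0]]]; apply: mf_inflation.
- exact: inj_comp (ses_inj t1) (ses_inj s1).
- exact: inj_comp (ses_inj t0) (ses_inj s0).
- move=> K r sr; have [u [v uv]] := cokernel_comp_ses s1 t1 sr.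
  exact: (gp_ext noethS uv (mf_gproj1 _) (mf_gproj1 _)).
- move=> K r sr; have [u [v uv]] := cokernel_comp_ses s0 t0 sr.
  exact: (gp_ext noethS uv (mf_gproj0 _) (mf_gproj0 _)).
Qed.

Lemma mf_comp_deflation A B X (p : hom A B) (q : hom B X) :
  deflation xi p -> deflation xi q -> deflation xi (q ∘ p).
Proof.
move=> [C [i [s1 s0]]] [D [j [t1 t0]]].
apply: mf_deflation.
- move=> z; have [y <-] := ses_surj t1 z; have [x <-] := ses_surj s1 y.
  by exists x.
- move=> z; have [y <-] := ses_surj t0 z; have [x <-] := ses_surj s0 y.
  by exists x.
- move=> K r sr; have [u [v [uv _ _]]] := kernel_comp_ses t1 s1 sr.
  exact: (gp_ext noethS uv (mf_gproj1 _) (mf_gproj1 _)).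
- move=> K r sr; have [u [v [uv _ _]]] := kernel_comp_ses t0 s0 sr.
  exact: (gp_ext noethS uv (mf_gproj0 _) (mf_gproj0 _)).
Qed.

(** The pushout is formed componentwise. Each component is an extension of one of [C] by one of [X],
    hence Gorenstein projective, and the structure maps come from the universal property of the
    modules. *)
Lemma mf_pushout A B X (i : hom A B) (f : hom A X) : inflation xi i ->
  exists Y (i' : hom X Y) (f' : hom B Y),
    is_pushout i f i' f' /\ inflation xi i'.
Proof.
move=> [C [p [s1 s0]]].
have [Y1 [i1 [f1 po1]]] := mod_pushout_exists (mf_phi1 i) (mf_phi1 f).
have [Y0 [i0 [f0 po0]]] := mod_pushout_exists (mf_phi0 i) (mf_phi0 f).
have [c1 t1] := mod_pushout_ses_exists po1 s1.
have [c0 t0] := mod_pushout_ses_exists po0 s0.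
have gp1 := gp_ext noethS t1 (mf_gproj1 X) (mf_gproj1 C).
have gp0 := gp_ext noethS t0 (mf_gproj0 X) (mf_gproj0 C).
have [comm1 _ _] := po1; have [comm0 _ _] := po0.
have [|g1 [g1i g1f]] := mod_pushout_desc po1
    (u := i0 \o mf_g1 X) (v := f0 \o mf_g1 B).
  by move=> x; rewrite /= !mf_comm1.
have [|g0 [g0i g0f]] := mod_pushout_desc po0
    (u := i1 \o mf_g0 X) (v := f1 \o mf_g0 B).
  by move=> x; rewrite /= !mf_comm0.
have g1g0 : forall x, g1 (g0 x) = w *: x.
  apply: (mod_pushout_ext po0 (u := g1 \o g0) (v := *:%R w)) => x /=.
    by rewrite g0i /= g1i /= mf_g1g0 linearZ.
  by rewrite g0f /= g1f /= mf_g1g0 linearZ.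
have g0g1 : forall x, g0 (g1 x) = w *: x.
  apply: (mod_pushout_ext po1 (u := g0 \o g1) (v := *:%R w)) => x /=.
    by rewrite g1i /= g0i /= mf_g0g1 linearZ.
  by rewrite g1f /= g0f /= mf_g0g1 linearZ.
pose Y : MF w := MFObject gp1 gp0 g1g0 g0g1.
pose i' : hom X Y := @MFHom _ _ X Y i1 i0 g1i g0i.
pose f' : hom B Y := @MFHom _ _ B Y f1 f0 g1f g0f.
have poY : is_pushout i f i' f'.
  split=> [|T u v uv]; first by apply: mf_ext.
  have [|v1 [v1i v1f]] := mod_pushout_desc po1
    (u := mf_phi1 u) (v := mf_phi1 v).
    by move=> x; exact: (mf_phi1_eq x uv).
  have [|v0 [v0i v0f]] := mod_pushout_desc po0
    (u := mf_phi0 u) (v := mf_phi0 v).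
    by move=> x; exact: (mf_phi0_eq x uv).
  have d1 : forall x, mf_g1 T (v1 x) = v0 (mf_g1 Y x).
    apply: (mod_pushout_ext po1 (u := mf_g1 T \o v1) (v := v0 \o g1)) => x /=.
      by rewrite v1i g1i /= v0i mf_comm1.
    by rewrite v1f g1f /= v0f mf_comm1.
  have d0 : forall x, mf_g0 T (v0 x) = v1 (mf_g0 Y x).
    apply: (mod_pushout_ext po0 (u := mf_g0 T \o v0) (v := v1 \o g0)) => x /=.
      by rewrite v0i g0i /= v1i mf_comm0.
    by rewrite v0f g0f /= v1f mf_comm0.
  exists (@MFHom _ _ Y T v1 v0 d1 d0); split; first by split; apply: mf_ext.
  move=> h [hi hf]; apply: mf_ext.
    apply: (mod_pushout_ext po1) => x /=.
      by rewrite v1i; apply/esym/(mf_phi1_eq x hi).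
    by rewrite v1f; apply/esym/(mf_phi1_eq x hf).
  apply: (mod_pushout_ext po0) => x /=.
    by rewrite v0i; apply/esym/(mf_phi0_eq x hi).
  by rewrite v0f; apply/esym/(mf_phi0_eq x hf).
exists Y, i', f'; split=> //.
(* The pair of 0 and [p] induces the map from [Y] to [C] that completes [i'] to a conflation. *)
have [|h [[hi hf] _]] := poY.2 C 0 p.
  rewrite comp0m; apply: mf_ext => x; first exact/esym/(ses_comp s1).
  exact/esym/(ses_comp s0).
exists C, h; split.
  apply: (mod_pushout_ses po1 s1) => x; first exact: (mf_phi1_eq x hi).
  exact: (mf_phi1_eq x hf).
apply: (mod_pushout_ses po0 s0) => x; first exact: (mf_phi0_eq x hi).
exact: (mf_phi0_eq x hf).
Qed.

(** Dual to [mf_pushout]: each component of [Y] is an extension of one of [X] by one of [C]. *)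
Lemma mf_pullback A B X (p : hom B A) (f : hom X A) : deflation xi p ->
  exists Y (p' : hom Y X) (f' : hom Y B),
    is_pullback p f p' f' /\ deflation xi p'.
Proof.
move=> [C [i [s1 s0]]].
have [Y1 [p1 [f1 pb1]]] := mod_pullback_exists (mf_phi1 p) (mf_phi1 f).
have [Y0 [p0 [f0 pb0]]] := mod_pullback_exists (mf_phi0 p) (mf_phi0 f).
have [c1 t1] := mod_pullback_ses_exists pb1 s1.
have [c0 t0] := mod_pullback_ses_exists pb0 s0.
have gp1 := gp_ext noethS t1 (mf_gproj1 C) (mf_gproj1 X).
have gp0 := gp_ext noethS t0 (mf_gproj0 C) (mf_gproj0 X).
have [comm1 _ _] := pb1; have [comm0 _ _] := pb0.
have [|g1 [g1p g1f]] := mod_pullback_lift pb0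
    (u := mf_g1 X \o p1) (v := mf_g1 B \o f1).
  by move=> x; rewrite /= -!mf_comm1 comm1.
have [|g0 [g0p g0f]] := mod_pullback_lift pb1
    (u := mf_g0 X \o p0) (v := mf_g0 B \o f0).
  by move=> x; rewrite /= -!mf_comm0 comm0.
have g1g0 x : g1 (g0 x) = w *: x.
  apply: (mod_pullback_inj pb0).
    by rewrite g1p /= g0p /= mf_g1g0 linearZ.
  by rewrite g1f /= g0f /= mf_g1g0 linearZ.
have g0g1 x : g0 (g1 x) = w *: x.
  apply: (mod_pullback_inj pb1).
    by rewrite g0p /= g1p /= mf_g0g1 linearZ.
  by rewrite g0f /= g1f /= mf_g0g1 linearZ.
pose Y : MF w := MFObject gp1 gp0 g1g0 g0g1.
pose p' : hom Y X := @MFHom _ _ Y X p1 p0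
  (fun x => esym (g1p x)) (fun x => esym (g0p x)).
pose f' : hom Y B := @MFHom _ _ Y B f1 f0
  (fun x => esym (g1f x)) (fun x => esym (g0f x)).
have pbY : is_pullback p f p' f'.
  split=> [|T u v uv]; first by apply: mf_ext.
  have [|v1 [v1p v1f]] := mod_pullback_lift pb1
    (u := mf_phi1 u) (v := mf_phi1 v).
    by move=> x; exact: (mf_phi1_eq x uv).
  have [|v0 [v0p v0f]] := mod_pullback_lift pb0
    (u := mf_phi0 u) (v := mf_phi0 v).
    by move=> x; exact: (mf_phi0_eq x uv).
  have d1 x : mf_g1 Y (v1 x) = v0 (mf_g1 T x).
    apply: (mod_pullback_inj pb0) => /=.
      by rewrite g1p /= v1p v0p mf_comm1.
    by rewrite g1f /= v1f v0f mf_comm1.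
  have d0 x : mf_g0 Y (v0 x) = v1 (mf_g0 T x).
    apply: (mod_pullback_inj pb1) => /=.
      by rewrite g0p /= v0p v1p mf_comm0.
    by rewrite g0f /= v0f v1f mf_comm0.
  exists (@MFHom _ _ T Y v1 v0 d1 d0); split; first by split; apply: mf_ext.
  move=> h [hp hf]; apply: mf_ext => x.
    apply: (mod_pullback_inj pb1) => /=.
      by rewrite v1p; apply/esym/(mf_phi1_eq x hp).
    by rewrite v1f; apply/esym/(mf_phi1_eq x hf).
  apply: (mod_pullback_inj pb0) => /=.
    by rewrite v0p; apply/esym/(mf_phi0_eq x hp).
  by rewrite v0f; apply/esym/(mf_phi0_eq x hf).
exists Y, p', f'; split=> //.
have [|h [[hp hf] _]] := pbY.2 C 0 i.
  rewrite compm0; apply: mf_ext => x; first exact/esym/(ses_comp s1).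
  exact/esym/(ses_comp s0).
exists C, h; split.
  apply: (mod_pullback_ses pb1 s1) => x; first exact: (mf_phi1_eq x hp).
  exact: (mf_phi1_eq x hf).
apply: (mod_pullback_ses pb0 s0) => x; first exact: (mf_phi0_eq x hp).
exact: (mf_phi0_eq x hf).
Qed.

Lemma mf_exact : exact_category xi.
Proof.
split.
- exact: mf_additive.
- exact: mf_ses_kernel_cokernel.
- exact: mf_ses_iso_closed.
- exact: mf_idm_inflation.
- exact: mf_idm_deflation.
- exact: mf_comp_inflation.
- exact: mf_comp_deflation.
- exact: mf_pushout.
- exact: mf_pullback.
Qed.

End MatrixFactorizationExact.

(** * The Frobenius structure *)

Section MatrixFactorizationFrobenius.
Variables (S : comNzRingType) (w : S).
Hypothesis noethS : noetherian S.
Implicit Types (A B X Y E : MF w) (C K L P Q : lmodType S).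
Local Notation xi := (mf_ses (w := w)).

(* A morphism out of (P -w-> P, P -1-> P) is determined by its component on
   [mf0], and a morphism into it by its component on [mf1]. *)
Lemma mf_w_id_projective P (hP : fg_projective P) :
  projective_object xi (mf_w_id w hP).
Proof.
have [_ projP] := hP; move=> A B p f [C [i [_ s0]]].
have [h hE] := projP _ _ _ (mf_phi0 f) (ses_surj s0).
have c1 x : mf_g1 A (mf_g0 A (h x)) = h (w *: x) by rewrite mf_g1g0 linearZ.
exists (@MFHom _ _ (mf_w_id w hP) A (mf_g0 A \o h) h c1 (fun=> erefl)).
apply: mf_ext => x; last exact: hE.
transitivity (mf_g0 B (mf_phi0 p (h x))); first exact/esym/mf_comm0.
by rewrite hE; exact: (mf_comm0 f x).
Qed.

Lemma mf_id_w_projective P (hP : fg_projective P) :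
  projective_object xi (mf_id_w w hP).
Proof.
have [_ projP] := hP; move=> A B p f [C [i [s1 _]]].
have [h hE] := projP _ _ _ (mf_phi1 f) (ses_surj s1).
have c0 x : mf_g0 A (mf_g1 A (h x)) = h (w *: x) by rewrite mf_g0g1 linearZ.
exists (@MFHom _ _ (mf_id_w w hP) A h (mf_g1 A \o h) (fun=> erefl) c0).
apply: mf_ext => x; first exact: hE.
transitivity (mf_g1 B (mf_phi1 p (h x))); first exact/esym/mf_comm1.
by rewrite hE; exact: (mf_comm1 f x).
Qed.

(** It suffices to extend the component on [mf1], whose cokernel is Gorenstein projective; the other
    component is forced to be [h \o mf_g0 B]. *)
Lemma mf_w_id_injective P (hP : fg_projective P) :
  injective_object xi (mf_w_id w hP).
Proof.
move=> A B i f [C [p [s1 _]]].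
have [h hE] := gp_extend noethS (mf_phi1 f) s1 (mf_gproj1 C) hP.
have c1 x : w *: h x = h (mf_g0 B (mf_g1 B x)) by rewrite mf_g0g1 linearZ.
exists (@MFHom _ _ B (mf_w_id w hP) h (h \o mf_g0 B) c1 (fun=> erefl)).
apply: mf_ext => x; first exact: hE.
transitivity (h (mf_g0 B (mf_phi0 i x))); first by [].
by rewrite mf_comm0 hE; exact/esym/(mf_comm0 f x).
Qed.

Lemma mf_id_w_injective P (hP : fg_projective P) :
  injective_object xi (mf_id_w w hP).
Proof.
move=> A B i f [C [p [_ s0]]].
have [h hE] := gp_extend noethS (mf_phi0 f) s0 (mf_gproj0 C) hP.
have c0 x : w *: h x = h (mf_g1 B (mf_g0 B x)) by rewrite mf_g1g0 linearZ.
exists (@MFHom _ _ B (mf_id_w w hP) (h \o mf_g1 B) h (fun=> erefl) c0).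
apply: mf_ext => x; last exact: hE.
transitivity (h (mf_g1 B (mf_phi1 i x))); first by [].
by rewrite mf_comm1 hE; exact/esym/(mf_comm1 f x).
Qed.

Lemma elementary_projective E : is_elementary E -> projective_object xi E.
Proof.
move=> [P [Q [hP [hQ bE]]]]; apply: (projective_object_biproduct bE).
  exact: mf_w_id_projective.
exact: mf_id_w_projective.
Qed.

Lemma elementary_injective E : is_elementary E -> injective_object xi E.
Proof.
move=> [P [Q [hP [hQ bE]]]]; apply: (injective_object_biproduct bE).
  exact: mf_w_id_injective.
exact: mf_id_w_injective.
Qed.

Lemma summand_of_elementary_projective X :
  summand_of_elementary X -> projective_object xi X.
Proof.
move=> [k [E [Z [elE [inj [prj [_ _ idZ]]] /projective_object_summand]]]].
apply; apply: (projective_object_sum idZ) => j; exact: elementary_projective.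
Qed.

Lemma summand_of_elementary_injective X :
  summand_of_elementary X -> injective_object xi X.
Proof.
move=> [k [E [Z [elE [inj [prj [_ _ idZ]]] /injective_object_summand]]]].
apply; apply: (injective_object_sum idZ) => j; exact: elementary_injective.
Qed.

Lemma summand_elementary X E : is_elementary E -> is_direct_summand X E ->
  summand_of_elementary X.
Proof.
by move=> elE XE; exists 1%N, (fun=> E), E; split=> //;
  exact: direct_sum_single.
Qed.

Lemma mf_pair_elementary P Q (hP : fg_projective P) (hQ : fg_projective Q) :
  is_elementary (mf_pair noethS (mf_w_id w hP) (mf_id_w w hQ)).
Proof. by exists P, Q, hP, hQ; exact: mf_pair_biproduct. Qed.

Lemma elementary_cover X : exists E (p : hom E X),
  is_elementary E /\ deflation xi p.
Proof.
have [[/free_cover[k1 [p1 s1]] _ _ _] [/free_cover[k0 [p0 s0]] _ _ _]] :=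
  (mf_gproj1 X, mf_gproj0 X).
have [hP hQ] := (fg_projective_row S k0, fg_projective_row S k1).
pose E := mf_pair noethS (mf_w_id w hP) (mf_id_w w hQ).
(* The free module [P] covers [mf0 X] and [Q] covers [mf1 X]; the summand on [P] contributes the
   morphism ([g0 p0], [p0]) and the summand on [Q] contributes ([p1], [g1 p1]). *)
pose q1 := copair_lin (mf_g0 X \o p0) p1.
pose q0 := copair_lin p0 (mf_g1 X \o p1).
have c1 x : mf_g1 X (q1 x) = q0 (mf_g1 E x).
  by rewrite !copair_linE linearD /= mf_g1g0 linearZ.
have c0 x : mf_g0 X (q0 x) = q1 (mf_g0 E x).
  by rewrite !copair_linE linearD /= mf_g0g1 linearZ.
exists E, (@MFHom _ _ E X q1 q0 c1 c0); split; first exact: mf_pair_elementary.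
have hPQ := fg_projective_pair hP hQ.
apply: mf_deflation => [x|x|K k sk|K k sk].
- have [y yE] := s1 x; exists (0, y).
  by rewrite -[LHS]/(q1 (0, y)) copair_linE /= !linear0 add0r.
- have [y yE] := s0 x; exists (y, 0).
  by rewrite -[LHS]/(q0 (y, 0)) copair_linE /= !linear0 addr0.
- exact: (gp_syzygy noethS sk hPQ (mf_gproj1 X)).
- exact: (gp_syzygy noethS sk hPQ (mf_gproj0 X)).
Qed.

(** Up to a sign, [L] is the pushout of [i] along [f], hence an extension of [C] by [Q]. *)
Lemma gp_cokernel_pair K P C Q L (i : {linear K -> P}) (p : {linear P -> C})
    (f : {linear K -> Q}) (e : {linear (P * Q)%type -> L}) :
  short_exact i p -> gorenstein_projective C -> gorenstein_projective Q ->
  short_exact (pair_lin i f) e -> gorenstein_projective L.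
Proof.
move=> ip gC gQ se.
have eE x y : e (x, y) = e (0, y) + e (x, 0).
  by rewrite -linearD; congr (e (_, _)); rewrite /= ?addr0 ?add0r.
have eN y : e (0, - y) = - e (0, y).
  by rewrite -linearN; congr (e (_, _)); rewrite /= oppr0.
pose f' : {linear P -> L} := e \o pair_lin idfun 0.
(* The sign turns the relation [e (i a, f a) = 0] into commutativity of the pushout square. *)
pose i' : {linear Q -> L} := - (e \o pair_lin 0 idfun : {linear Q -> L}).
have po : mod_pushout i f i' f'.
  split=> [a|z|x b].
  - apply/eqP; rewrite -subr_eq0 -opprD oppr_eq0; apply/eqP.
    by rewrite -[LHS]eE; exact: (ses_comp se).
  - have [[x y] <-] := ses_surj se z; exists (- y), x.
    by rewrite eE /i' lin_oppE /= eN opprK.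
  - rewrite [i' x](esym (eN x)) => xb.
    have [|a [ia fa]] := ses_ker se (y := (b, - x)); first by rewrite eE.
    by exists (- a); rewrite linearN ?ia ?fa ?opprK.
have [v iv] := mod_pushout_ses_exists po ip.
exact: (gp_ext noethS iv gQ gC).
Qed.

Lemma elementary_hull X : exists E (i : hom X E),
  is_elementary E /\ inflation xi i.
Proof.
have [P [C1 [m1 [d1 [hP gC1 s1]]]]] := gp_embed noethS (mf_gproj1 X).
have [Q [C0 [m0 [d0 [hQ gC0 s0]]]]] := gp_embed noethS (mf_gproj0 X).
pose E := mf_pair noethS (mf_w_id w hP) (mf_id_w w hQ).
(* Dually to the cover, [m1] on [mf1 X] determines a morphism into the summand on [P], and [m0] on
   [mf0 X] one into the summand on [Q]. *)
pose i1 := pair_lin m1 (m0 \o mf_g1 X).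
pose i0 := pair_lin (m1 \o mf_g0 X) m0.
have c1 x : mf_g1 E (i1 x) = i0 (mf_g1 X x).
  by rewrite /= mf_g0g1 linearZ.
have c0 x : mf_g0 E (i0 x) = i1 (mf_g0 X x).
  by rewrite /= mf_g1g0 linearZ.
exists E, (@MFHom _ _ X E i1 i0 c1 c0); split; first exact: mf_pair_elementary.
have [gP gQ] := (fg_projective_gorenstein hP, fg_projective_gorenstein hQ).
apply: mf_inflation => [x y [/(ses_inj s1)]|x y [_ /(ses_inj s0)]|K k sk|
  K k sk] //.
  exact: (gp_cokernel_pair s1 gC1 gQ sk).
(* On [mf0] the embedding [m0] with known cokernel is the second coordinate, so the factors are
   swapped to fit [gp_cokernel_pair]. *)
have [sw swK] : exists sw : {linear (Q * P)%type -> (P * Q)%type},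
    forall x y, sw (x, y) = (y, x) by exists (pair_lin snd fst).
apply: (gp_cokernel_pair (f := m1 \o mf_g0 X) (e := k \o sw) s0 gC0 gP).
split=> [x y [/(ses_inj s0)]//|[x y]|z].
  rewrite /= swK; split=> [/(ses_ker sk)[t [<- <-]]|[t [<- <-]]];
    first by exists t.
  exact: (ses_comp sk).
by have [[x y] <-] := ses_surj sk z; exists (y, x); rewrite /= swK.
Qed.

Lemma projective_summand_of_elementary X :
  projective_object xi X -> summand_of_elementary X.
Proof.
move=> projX; have [E [p [elE dp]]] := elementary_cover X.
have [s ps] := projX _ _ p (idm X) dp; have [A [i ip]] := dp.
apply: (summand_elementary elE); exists A.
by apply: (split_epi_biproduct _ ps); exact: (mf_ses_kernel_cokernel ip).1.
Qed.

Lemma injective_summand_of_elementary X :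
  injective_object xi X -> summand_of_elementary X.
Proof.
move=> injX; have [E [i [elE di]]] := elementary_hull X.
have [r ri] := injX _ _ i (idm X) di; have [A [p ip]] := di.
apply: (summand_elementary elE); exists A.
by apply: (split_mono_biproduct _ ri); exact: (mf_ses_kernel_cokernel ip).2.
Qed.

Lemma mf_frobenius : frobenius_category xi.
Proof.
split; first exact: mf_exact.
- move=> X; have [E [p [elE dp]]] := elementary_cover X.
  by exists E, p; split=> //; exact: elementary_projective.
- move=> X; have [E [i [elE di]]] := elementary_hull X.
  by exists E, i; split=> //; exact: elementary_injective.
- move=> X; split.
    move=> /projective_summand_of_elementary;
      exact: summand_of_elementary_injective.
  move=> /injective_summand_of_elementary;
    exact: summand_of_elementary_projective.
Qed.

End MatrixFactorizationFrobenius.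

Theorem proposition3p8 (S : comNzRingType) (n : {pred S}) (w : S)
    (hS : noetherian S) (hn : local_ring n)
    (hwn : w \in n) (hw : GRing.lreg w) :
  [/\ exact_category (mf_ses (w := w)),
      frobenius_category (mf_ses (w := w))
    & forall X : MF w,
        (projective_object (mf_ses (w := w)) X /\
         injective_object (mf_ses (w := w)) X) <->
        summand_of_elementary X].
Proof.
split; [exact: mf_exact|exact: mf_frobenius|move=> X].
split=> [[projX _]|elX]; first exact: projective_summand_of_elementary.
split; first exact: summand_of_elementary_projective.
exact: summand_of_elementary_injective.
Qed.
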